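(* Let $\theta>0$ be a constant and suppose that for each $N\in\mathbb{N}$ the composition of the surplus capacity distribution function and the load surge function satisfies $F(l^N(i))=\frac{\theta+i-1}{N}$ (to be read as $\min\{1,\frac{\theta+i-1}{N}\}$), $i=1,\dots,N$. Let $k:=k(N)\le N$ be a positive function of $N$ such that $k\to\infty$ and $N-k\to\infty$ as $N\to\infty$. Then $$\lim_{N\to\infty}\sqrt{\frac{kN}{N-k}}\;\mathbb{P}(A^N\ge k)=\frac{2\theta}{\sqrt{2\pi}}.$$
   Context: Model. For each $N\in\mathbb{N}$ a network has $N$ lines with i.i.d. surplus capacities $C^N(1),\dots,C^N(N)$ having a common continuous distribution function $F$ with strictly positive density at zero. Let $C^N_{(1)}\le\dots\le C^N_{(N)}$ be the ordered surplus capacities. The load surge function $l^N(\cdot)$ is deterministic and increasing. The number of failed lines (blackout size) is $A^N=\max\{k\in\{1,\dots,N\}: C^N_{(i)}\le l^N(i)\text{ for all } i=1,\dots,k\}$, and $A^N=0$ if $C^N_{(1)}>l^N(1)$. Equivalently in distribution, $\mathbb{P}(A^N\ge k)=\mathbb{P}(U^N_{(i)}\le F(l^N(i)),\ i=1,\dots,k)$ for integers $1\le k\le N$, where $U^N_{(1)}\le\dots\le U^N_{(N)}$ are the order statistics of $N$ independent uniform random variables on $[0,1]$. *)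

(* Defs.v *)
From HB Require Import structures.
From mathcomp Require Import all_boot all_order all_algebra.
From mathcomp Require Import all_classical all_reals all_analysis.
Set Implicit Arguments.
Unset Strict Implicit.
Unset Printing Implicit Defensive.
Import Order.TTheory GRing.Theory Num.Theory.
Import numFieldNormedType.Exports.
Local Open Scope classical_set_scope.
Local Open Scope ring_scope.

(* The product rule is required for every subfamily J of the finite index
   type I. *)
Definition mutually_independent (R : realType) (d : measure_display)
    (T : measurableType d) (P : probability T R) (I : finType)
    (X : I -> {RV P >-> R}) : Prop :=
  forall (J : {set I}) (B : I -> set R),
    (forall j, measurable (B j)) ->
    P (\bigcap_(j in [set j | j \in J]) (X j @^-1` B j)) =
    (\prod_(j in J) P (X j @^-1` B j))%E.

(* The density at zero is the right derivative of F at 0, so that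
   distributions carried by [0, +oo[ are included; a distribution with a
   two-sided derivative at 0 is covered as well. *)
Definition positive_density_at_zero (R : realType) (F : R -> R) : Prop :=
  exists2 f0 : R, 0 < f0 & (F h - F 0) / h @[h --> 0^'+] --> f0.

(* The i-th smallest entry of x, for 1 <= i <= N. *)
Definition order_stat (R : realType) (N : nat) (x : 'I_N -> R) (i : nat) : R :=
  nth 0 (sort <=%R [seq x j | j <- enum 'I_N]) i.-1.

(* The empty maximum is 0; this is the case l 1 < order_stat c 1. *)
Definition blackout_size (R : realType) (N : nat) (l : nat -> R)
    (c : 'I_N -> R) : nat :=
  \max_(1 <= k < N.+1 | all (fun i => order_stat c i <= l i) (iota 1 k)) k.

(* Main.v *)
Require Import Defs.
From mathcomp Require Import all_boot all_order all_algebra.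
From mathcomp Require Import all_classical all_reals all_analysis.
From mathcomp Require Import ring lra zify.
Import Order.TTheory GRing.Theory Num.Theory.
Import numFieldNormedType.Exports.
Set Implicit Arguments.
Unset Strict Implicit.
Unset Printing Implicit Defensive.
Local Open Scope classical_set_scope.
Local Open Scope ring_scope.

(** The cascade stops after exactly j failures when some set T of j lines fails
    completely on its own, that is, the i-th smallest capacity in T is at most
    l i for every i <= j, while every other line has capacity above l (j + 1).
    For each outcome there is exactly one such T.  The same holds for the
    cascade restricted to any set S of lines, so the probability g n that n
    given lines fail completely satisfies, with p j = F (l j),
    \[ \sum_(j <= n) 'C(n, j) g j (1 - p (j + 1))^(n - j) = 1. \]
    This recursion determines g, and for p j = (theta + j - 1) / N it is Abel's
    binomial identity: g n = theta (theta + n)^(n - 1) / N^n.  Hence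
    P(A = j) = 'C(N, j) theta (theta + j)^(j - 1) (N - theta - j)^(N - j) / N^N
    as long as theta + j <= N.  Abel's identity also says that the right-hand
    sides add up to 1 over 0 <= j <= N.  So, if theta + k - 1 <= N, then
    P(A >= k) is their sum over k <= j <= N ([prob_blackout_ge_failure_pmf]),
    although the terms with theta + j > N need not be probabilities.

    For the asymptotics let b j = 2 theta / sqrt(2 pi) sqrt((N - j) / (j N)),
    which is the claimed approximation of P(A >= j).  By Stirling's formula the
    j-th term is b j - b (j + 1) times a factor composed of functions of j
    alone, of N - j alone and of N alone, each of which converges; so the factor
    tends to 1 uniformly when j and N - j are both large
    ([failure_pmf_local_ratio], [cvg_local_ratio]).  The sum over
    k <= j <= N - M therefore telescopes to b k up to a small relative error.
    The last M terms are O(1 / N) each ([failure_pmf_bound]), and b k is at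
    least of order sqrt(N - k) / N, so they are negligible because N - k
    tends to infinity ([tail_sum_approx]).

    The constant sqrt(2 pi) in Stirling's formula comes from Wallis' product,
    which is read off from explicit antiderivatives of the powers of cos. *)

(** * Abel's binomial identity *)

Lemma deriv_horner_inj (R : numFieldType) (p q : {poly R}) (a : R) :
  p^`() = q^`() -> p.[a] = q.[a] -> p = q.
Proof.
move=> dpq pq_a; apply/eqP; rewrite -subr_eq0; set r := p - q.
have r_const : r = (r`_0)%:P.
  apply/polyP => -[|i]; rewrite coefC //=.
  have /eqP : r^`()`_i = 0 by rewrite derivB dpq subrr coef0.
  by rewrite coef_deriv mulrn_eq0 /= => /eqP.
have : r.[a] = 0 by rewrite hornerD hornerN pq_a subrr.
by rewrite r_const hornerC => ->.
Qed.

(** The operator p |-> x p + 'X p^`() multiplies 'X^j by x + j, so m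
    applications of it to ('X - 1)^n produce the polynomial with these
    coefficients.  Each application lowers the multiplicity of the root 1 by at
    most one, hence for m < n the result still vanishes at 1. *)
Lemma alternating_binomial_sum0 (R : comNzRingType) (x : R) (n m : nat) :
  (m < n)%N ->
  \sum_(j < n.+1) 'C(n, j)%:R * (-1) ^+ (n - j) * (x + j%:R) ^+ m = 0.
Proof.
move=> lt_mn.
pose L (p : {poly R}) := x *: p + 'X * p^`().
have L_sum (c : 'I_n.+1 -> R) :
    L (\sum_j c j *: 'X^j) = \sum_j (c j * (x + j%:R)) *: 'X^j.
  rewrite /L scaler_sumr raddf_sum mulr_sumr -big_split /=.
  apply: eq_bigr => j _; rewrite derivZ derivXn scalerA -scalerAr.
  case: (nat_of_ord j) => [|i]; first by rewrite mulr0n mulr0 scaler0 !addr0 mulrC.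
  by rewrite mulrnAr -exprS -scaler_nat scalerA -scalerDl mulrDr [c j * x]mulrC.
have iterL i : (i <= n)%N -> exists q, iter i L (('X - 1) ^+ n) = ('X - 1) ^+ (n - i) * q.
  elim: i => [_|i IHi lt_in]; first by exists 1; rewrite subn0 mulr1.
  have [q /= ->] := IHi (ltnW lt_in).
  exists (x *: (('X - 1) * q) + 'X * (q *+ (n - i) + ('X - 1) * q^`())).
  rewrite /L (_ : (n - i)%N = (n - i.+1).+1); last by rewrite subnSK.
  rewrite derivM deriv_exp derivB derivX derivC subr0 mul1r exprS /=.
  rewrite -[q *+ _]mulr_natr -[_ ^+ _ *+ _]mulr_natr -!mul_polyC.
  ring.
have iterL_sum i : iter i L (('X - 1) ^+ n) =
    \sum_(j < n.+1) ('C(n, j)%:R * (-1) ^+ (n - j) * (x + j%:R) ^+ i) *: 'X^j.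
  elim: i => [|i IHi /=].
    rewrite /= addrC exprDn; apply: eq_bigr => j _.
    by rewrite expr0 mulr1 -scaler_nat -!mul_polyC rmorphM rmorphXn /= rmorphN1 mulrA
      rmorph_nat.
  rewrite IHi L_sum; apply: eq_bigr => j _.
  by rewrite exprSr mulrA.
have [q Eq] := iterL _ (ltnW lt_mn).
move: (congr1 (fun p => p.[1]) (iterL_sum m)); rewrite Eq.
rewrite hornerM horner_exp hornerD hornerX hornerN hornerC subrr expr0n.
rewrite subn_eq0 leqNgt lt_mn mul0r horner_sum => sum0.
rewrite [RHS]sum0; by apply: eq_bigr => j _; rewrite hornerZ hornerXn expr1n mulr1.
Qed.

(** The product x (x + j)^(j - 1), whose value at j = 0 is 1. *)
Definition abel_poly (R : pzRingType) (x : R) (j : nat) : R :=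
  if j is i.+1 then x * (x + j%:R) ^+ i else 1.

(** Both sides are polynomials in y.  The derivative of the n-th identity is n
    times the (n - 1)-st one, and at y = - x the left-hand side is an
    alternating binomial sum of a polynomial of degree n - 1. *)
Lemma abel_identity (R : numFieldType) (x y : R) (n : nat) :
  \sum_(j < n.+1) 'C(n, j)%:R * abel_poly x j * (y - j%:R) ^+ (n - j)
  = (x + y) ^+ n.
Proof.
pose p n : {poly R} :=
  \sum_(j < n.+1) ('C(n, j)%:R * abel_poly x j) *: ('X - j%:R%:P) ^+ (n - j).
suff {y} pE : p n = ('X + x%:P) ^+ n.
  have := congr1 (fun q => q.[y]) pE.
  rewrite horner_exp hornerD hornerX hornerC addrC => <-.
  rewrite horner_sum; apply: eq_bigr => j _.
  by rewrite hornerZ horner_exp hornerXsubC.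
elim: n => [|n IHn]; first by rewrite /p big_ord1 bin0 mul1r scale1r.
apply: (@deriv_horner_inj _ _ _ (- x)).
  rewrite deriv_exp derivD derivX derivC addr0 mul1r -IHn /p big_ord_recr /=.
  rewrite derivD derivZ subnn derivC scaler0 addr0.
  rewrite raddf_sum -[RHS]scaler_nat scaler_sumr; apply: eq_bigr => j _ /=.
  rewrite derivZ deriv_exp derivXsubC mul1r subSn ?leq_ord // -[_ ^+ _ *+ _]scaler_nat !scalerA.
  congr (_ *: _); rewrite mulrAC -natrM mulrA -natrM; congr (_%:R * _).
  by rewrite (mul_bin_down n.+1) subSn ?leq_ord // mulnC.
rewrite horner_exp hornerD hornerX hornerC addNr expr0n /=.
rewrite horner_sum.
transitivity (x * \sum_(j < n.+2) 'C(n.+1, j)%:R * (-1) ^+ (n.+1 - j) * (x + j%:R) ^+ n).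
  rewrite mulr_sumr; apply: eq_bigr => j _.
  rewrite hornerZ horner_exp hornerXsubC -opprD [in LHS]exprNn.
  case: (nat_of_ord j) (leq_ord j) => [|i] le_i /=.
    by rewrite bin0 !mul1r subn0 addr0 [x ^+ n.+1]exprS; ring.
  have -> : (x + i.+1%:R) ^+ n = (x + i.+1%:R) ^+ i * (x + i.+1%:R) ^+ (n.+1 - i.+1).
    by rewrite subSS -exprD subnKC.
  by ring.
by rewrite alternating_binomial_sum0 ?mulr0.
Qed.

(** * The cascade on a set of lines *)

Definition count_le (R : realType) (I : finType) (c : I -> R) (S : {set I})
    (r : R) : nat :=
  #|[pred x in S | c x <= r]|.

Definition fails_up_to (R : realType) (I : finType) (l : nat -> R)
    (c : I -> R) (S : {set I}) (k : nat) : bool :=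
  all (fun i => (i <= count_le c S (l i))%N) (iota 1 k).

(** Counting the small entries, instead of sorting them, gives a condition that
    makes sense on every set of lines and is monotone in that set. *)
Definition fully_fails (R : realType) (I : finType) (l : nat -> R)
    (c : I -> R) (S : {set I}) : bool :=
  fails_up_to l c S #|S|.

Definition stops_at (R : realType) (I : finType) (l : nat -> R)
    (c : I -> R) (S T : {set I}) : bool :=
  fully_fails l c T && [forall x in S :\: T, l #|T|.+1 < c x].

Lemma fails_up_toP (R : realType) (I : finType) (l : nat -> R) (c : I -> R)
    (S : {set I}) (k : nat) :
  reflect (forall i, (1 <= i <= k)%N -> (i <= count_le c S (l i))%N)
          (fails_up_to l c S k).
Proof.
apply: (iffP allP) => [H i /andP[i1 ik]|H i]; first by apply: H; rewrite mem_iota i1 add1n.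
by rewrite mem_iota add1n => ?; apply: H.
Qed.

Lemma fully_fails_le (R : realType) (I : finType) (l : nat -> R) (c : I -> R)
    (T : {set I}) (x : I) :
  fully_fails l c T -> x \in T -> c x <= l #|T|.
Proof.
move=> /fails_up_toP ffT xT.
have T_gt0 : (0 < #|T|)%N by rewrite card_gt0; apply/set0Pn; exists x.
have := ffT #|T|; rewrite T_gt0 leqnn => /(_ isT) le_T.
have sub : [pred y in T | c y <= l #|T|] \subset T.
  by apply/fintype.subsetP => y; rewrite inE => /andP[].
have E : #|[pred y in T | c y <= l #|T| ]| = #|T|.
  by apply/eqP; rewrite eqn_leq subset_leq_card.
have /(subset_cardP E) /(_ x) := sub.
by rewrite xT inE => /andP[].
Qed.

(** Take the largest a such that the cascade on S reaches a failures, and for T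
    the lines of S with capacity at most l (a + 1): maximality of a gives
    #|T| <= a, and monotonicity of l gives the converse. *)
Lemma stops_at_exists (R : realType) (I : finType) (l : nat -> R) (c : I -> R)
    (S : {set I}) :
  (forall i j, (1 <= i)%N -> (i <= j)%N -> (j <= #|S|)%N -> l i <= l j) ->
  exists2 T : {set I}, T \subset S & stops_at l c S T.
Proof.
move=> l_incr.
have fails0 : exists k, (k <= #|S|)%N && fails_up_to l c S k by exists 0.
have bnd k : (k <= #|S|)%N && fails_up_to l c S k -> (k <= #|S|)%N by case/andP.
case: (ex_maxnP fails0 bnd) => a /andP[a_le /fails_up_toP aP] a_max.
have [aS|aS] := eqVneq a #|S|.
  exists S => //; apply/andP; split; first by rewrite /fully_fails -aS; apply/fails_up_toP.
  by apply/forall_inP => x; rewrite finset.setDv inE.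
have lt_aS : (a < #|S|)%N by rewrite ltn_neqAle aS.
pose T : {set I} := [set x in S | (c x <= l a.+1)%R]%SET.
have TS : T \subset S by apply/fintype.subsetP => x; rewrite inE => /andP[].
have cardT : #|T| = count_le c S (l a.+1) by rewrite /T cardsE.
have below_T i : (1 <= i <= a)%N -> count_le c T (l i) = count_le c S (l i).
  move=> /andP[i1 ia]; apply: eq_card => x; rewrite !inE.
  have [xS|//] := boolP (x \in S).
  apply: andb_idl => /le_trans; apply; apply: l_incr => //; exact: leqW.
have card_a : #|T| = a.
  apply/eqP; rewrite eqn_leq; apply/andP; split.
    rewrite leqNgt; apply/negP => lt_aT.
    suff /a_max : (a.+1 <= #|S|)%N && fails_up_to l c S a.+1 by rewrite ltnn.
    rewrite lt_aS; apply/fails_up_toP => i; rewrite [(i <= a.+1)%N]leq_eqVlt ltnS.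
    case/andP=> i1 /predU1P[->|ia]; first by rewrite -cardT.
    by apply: aP; rewrite i1.
  case: (posnP a) => [->//|a_gt0].
  apply: leq_trans (aP a _) _; first by rewrite a_gt0 /=.
  rewrite -below_T ?a_gt0 //=; apply: subset_leq_card.
  by apply/fintype.subsetP => x; rewrite inE => /andP[].
exists T => //; apply/andP; split.
  apply/fails_up_toP => i; rewrite card_a => ia.
  by rewrite below_T ?aP.
by apply/forall_inP => x; rewrite card_a !inE => /andP[+ xS]; rewrite xS /= ltNge.
Qed.

Lemma stops_at_count_lt (R : realType) (I : finType) (l : nat -> R) (c : I -> R)
    (S T : {set I}) :
  stops_at l c S T -> (count_le c S (l #|T|.+1) <= #|T|)%N.
Proof.
case/andP=> _ /forall_inP stopT; apply: subset_leq_card; apply/fintype.subsetP => x.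
rewrite inE => /andP[xS c_le]; apply/negPn/negP => xT.
by have := stopT x; rewrite inE xS xT => /(_ isT); rewrite ltNge c_le.
Qed.

(** A set at which the cascade stops determines how far the cascade goes; this
    gives both its uniqueness and its relation to the blackout size. *)
Lemma stops_at_fails_up_to (R : realType) (I : finType) (l : nat -> R)
    (c : I -> R) (S T : {set I}) (k : nat) :
  T \subset S -> stops_at l c S T -> (k <= #|S|)%N ->
  fails_up_to l c S k = (k <= #|T|)%N.
Proof.
move=> TS stopT kS; apply/idP/idP => [/fails_up_toP fk|k_le].
  rewrite leqNgt; apply/negP => lt_Tk.
  by have := leq_trans (fk #|T|.+1 lt_Tk) (stops_at_count_lt stopT); rewrite ltnn.
apply/fails_up_toP => i /andP[i1 ik].
case/andP: stopT => /fails_up_toP/(_ i); rewrite i1 (leq_trans ik k_le) => /(_ isT) iT _.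
apply: leq_trans iT _; apply: subset_leq_card; apply/fintype.subsetP => x.
by rewrite !inE => /andP[/(fintype.subsetP TS) -> ->].
Qed.

Lemma stops_at_uniq (R : realType) (I : finType) (l : nat -> R) (c : I -> R)
    (S T U : {set I}) :
  (forall i j, (1 <= i)%N -> (i <= j)%N -> (j <= #|S|)%N -> l i <= l j) ->
  T \subset S -> U \subset S -> stops_at l c S T -> stops_at l c S U -> T = U.
Proof.
move=> l_incr.
wlog le_TU : T U / (#|T| <= #|U|)%N => [wlg TS US sT sU|TS US sT sU].
  by case/orP: (leq_total #|T| #|U|) => ?; [|apply/esym]; exact: wlg.
have eqTU : #|U| = #|T|.
  apply/eqP; rewrite eqn_leq le_TU andbT.
  rewrite -(stops_at_fails_up_to TS sT) ?subset_leq_card //.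
  by rewrite (stops_at_fails_up_to US sU) ?subset_leq_card.
have [TeqS|TneS] := eqVneq #|T| #|S|.
  have/eqP-> : T == S by rewrite eqEcard TS TeqS /=.
  by apply/esym/eqP; rewrite eqEcard US eqTU TeqS /=.
have lt_TS : (#|T| < #|S|)%N by rewrite ltn_neqAle TneS subset_leq_card.
apply/eqP; rewrite eq_sym eqEcard eqTU leqnn andbT; apply/fintype.subsetP => x xU.
apply/negPn/negP => xT; case/andP: sT => _ /forall_inP /(_ x).
rewrite inE xT (fintype.subsetP US) // => /(_ isT); rewrite ltNge.
case/andP: sU => /fully_fails_le /(_ xU) + _.
rewrite eqTU => /le_trans -> //; apply: l_incr => //.
by rewrite -eqTU card_gt0; apply/set0Pn; exists x.
Qed.

Lemma order_stat_le (R : realType) (N : nat) (c : 'I_N -> R) (i : nat) (r : R) :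
  (1 <= i <= N)%N -> (order_stat c i <= r) = (i <= count_le c [set: 'I_N] r)%N.
Proof.
case: i => // i /andP[_ iN]; rewrite /order_stat /=.
set s := sort _ _.
have s_sorted : sorted <=%R s by exact: sort_le_sorted.
have s_size : size s = N by rewrite size_sort size_map size_enum_ord.
have -> : count_le c [set: 'I_N] r = count (<= r) s.
  rewrite /s (permP (permEl (perm_sort _ _))) count_map /count_le cardE.
  rewrite {1}/enum_mem size_filter -enumT.
  by apply: eq_count => j; rewrite !inE.
apply/idP/idP => [|lt_i]; last exact: nth_count_le.
apply: contraTT; rewrite -leqNgt -ltNge => le_i.
by apply: nth_count_gt => //; rewrite le_i s_size.
Qed.

Lemma blackout_size_stops_at (R : realType) (N : nat) (l : nat -> R)
    (c : 'I_N -> R) (T : {set 'I_N}) :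
  stops_at l c [set: 'I_N] T -> blackout_size l c = #|T|.
Proof.
move=> stopT.
have T_le : (#|T| <= N)%N by rewrite -[X in (_ <= X)%N](card_ord N) max_card.
have failE k : (k <= N)%N ->
    all (fun i => order_stat c i <= l i) (iota 1 k) = (k <= #|T|)%N.
  move=> kN; rewrite -(stops_at_fails_up_to _ stopT) ?cardsT ?card_ord ?finset.subsetT //.
  apply: eq_in_all => i; rewrite mem_iota add1n ltnS => /andP[i1 ik].
  by rewrite order_stat_le // i1 (leq_trans ik).
apply/eqP; rewrite eqn_leq; apply/andP; split.
  apply/bigmax_leqP_seq => k; rewrite mem_index_iota ltnS => /andP[_ kN].
  by rewrite failE.
case: (posnP #|T|) => [->//|T_gt0].
apply: (@leq_bigmax_seq _ (index_iota 1 N.+1)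
  (fun k => all (fun i => order_stat c i <= l i) (iota 1 k)) id).
  by rewrite mem_index_iota T_gt0 ltnS.
by rewrite failE.
Qed.

(** * The law of the blackout size *)

Lemma measure_finType_bigcup (R : realType) (d : measure_display)
    (T : measurableType d) (mu : {measure set T -> \bar R}) (I : finType)
    (Q : pred I) (E : I -> set T) :
  (forall i, Q i -> measurable (E i)) ->
  (forall i j t, Q i -> Q j -> E i t -> E j t -> i = j) ->
  mu (\bigcup_(i in [set i | Q i]) E i) = (\sum_(i | Q i) mu (E i))%E.
Proof.
move=> mE trivE; rewrite measure_fin_bigcup //; first last.
- by move=> i j /= Qi Qj [t [Eit Ejt]]; exact: trivE Ejt.
- exact: finite_finset.
rewrite -[RHS]big_enum (_ : [set i | Q i] = [set` enum Q]); last first.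
  by apply/seteqP; split => i /=; rewrite mem_enum.
exact/esym/fsbig_seq/enum_uniq.
Qed.

Lemma sum_subsets_by_card (V : nmodType) (I : finType) (S : {set I})
    (f : nat -> V) :
  \sum_(T : {set I} | T \subset S) f #|T|
  = \sum_(j < #|S|.+1) f j *+ 'C(#|S|, j).
Proof.
rewrite (partition_big (fun T : {set I} => inord #|T| : 'I_#|S|.+1) predT) //=.
apply: eq_bigr => j _; rewrite -cards_draws -sumr_const.
apply: eq_big => [T|T /andP[TS /eqP <-]].
  rewrite inE; apply: andb_id2l => /subset_leq_card TS.
  by rewrite -val_eqE /= inordK.
by rewrite inordK // ltnS subset_leq_card.
Qed.

Lemma measurable_fully_fails (R : realType) (d : measure_display)
    (T : measurableType d) (I : finType) (X : I -> {mfun T >-> R})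
    (l : nat -> R) (S : {set I}) :
  measurable [set w | fully_fails l (fun x => X x w) S].
Proof.
rewrite (_ : [set w | _] = \bigcap_(i in [set i | (1 <= i <= #|S|)%N])
    \bigcup_(U in [set U : {set I} | (U \subset S) && (i <= #|U|)%N])
      \bigcap_(x in [set x | x \in U]) X x @^-1` `]-oo, l i]).
  apply: bigcap_measurableType => i _; apply: fin_bigcup_measurable => [|U _].
    exact: finite_finset.
  by apply: fin_bigcap_measurable => [|x _]; [exact: finite_finset|exact: measurable_funPTI].
apply/seteqP; split => w /=.
  move=> /fails_up_toP fS i /= /fS i_le.
  exists [set x in S | (X x w <= l i)%R]%SET.
    rewrite /= cardsE i_le andbT.
    by apply/fintype.subsetP => x; rewrite inE => /andP[].
  by move=> x /=; rewrite inE in_itv /= => /andP[].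
move=> H; apply/fails_up_toP => i /H[U /= /andP[US iU] HU].
apply: leq_trans iU _; apply: subset_leq_card; apply/fintype.subsetP => x xU.
rewrite inE (fintype.subsetP US) //=.
by have := HU x xU; rewrite /= in_itv.
Qed.

(** The probability of failing completely and the independence of this event
    from the capacities outside S are asserted together, because the induction
    over S proves each of them with the help of the other. *)
Definition fails_indep (R : realType) (d : measure_display)
    (T : measurableType d) (P : probability T R) (I : finType)
    (X : I -> {RV P >-> R}) (l : nat -> R) (S : {set I}) (p : R) : Prop :=
  forall (J : {set I}) (B : I -> set R) (b : I -> R),
    [disjoint J & S]%B -> (forall x, measurable (B x)) ->
    (forall x, P (X x @^-1` B x) = (b x)%:E) ->
    P ([set w | fully_fails l (fun x => X x w) S] `&`
       \bigcap_(x in [set x | x \in J]) (X x @^-1` B x))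
    = (p * \prod_(x in J) b x)%:E.

(** Stopping at U is the conjunction of an event about the lines in U and of
    independent events about single lines outside U. *)
Lemma prob_stops_at (R : realType) (d : measure_display)
    (T : measurableType d) (P : probability T R) (I : finType)
    (X : I -> {RV P >-> R}) (F : R -> R) (l : nat -> R) (S U : {set I}) (p : R)
    (J : {set I}) (B : I -> set R) (b : I -> R) :
  (forall x r, cdf (X x) r = (F r)%:E) ->
  U \subset S -> fails_indep X l U p ->
  [disjoint J & S]%B -> (forall x, measurable (B x)) ->
  (forall x, P (X x @^-1` B x) = (b x)%:E) ->
  P ([set w | stops_at l (fun x => X x w) S U] `&`
     \bigcap_(x in [set x | x \in J]) (X x @^-1` B x))
  = (p * (1 - F (l #|U|.+1)) ^+ (#|S| - #|U|) * \prod_(x in J) b x)%:E.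
Proof.
move=> X_cdf US fU dJS mB PB.
set r := l #|U|.+1.
have dJSU : [disjoint J & S :\: U]%B.
  by apply: disjointWr dJS; apply: finset.subsetDl.
(* Apply the hypothesis on U to the larger family in which the lines of
   S minus U are required to exceed r. *)
pose B' x := if x \in J then B x else `]r, +oo[%classic.
pose b' x := if x \in J then b x else 1 - F r.
have mB' x : measurable (B' x) by rewrite /B'; case: ifP.
have PB' x : P (X x @^-1` B' x) = (b' x)%:E.
  rewrite /B' /b'; case: ifP => // _.
  rewrite -setCitvl preimage_setC probability_setC; last first.
    exact: (measurable_funPTI (X x) (measurable_itv `]-oo, r])).
  by have := X_cdf x r; rewrite /cdf /distribution /pushforward => ->.
have dU : [disjoint J :|: (S :\: U) & U]%B.
  rewrite disjoint_subset; apply/fintype.subsetP => x.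
  rewrite !inE => /orP[xJ|/andP[xU _]] //.
  by apply/negP => /(fintype.subsetP US); rewrite (disjointFr dJS).
have := fU _ _ _ dU mB' PB'.
rewrite (eq_bigl [predU J & S :\: U]) => [|x]; last by rewrite !inE.
rewrite bigU //=.
have -> : \prod_(x in J) b' x = \prod_(x in J) b x.
  by apply: eq_bigr => x xJ; rewrite /b' xJ.
have -> : \prod_(x in S :\: U) b' x = (1 - F r) ^+ (#|S| - #|U|).
  rewrite (eq_bigr (fun=> 1 - F r)) => [|x xSU].
    by rewrite prodr_const cardsD (finset.setIidPr US).
  by rewrite /b' (disjointFl dJSU xSU).
rewrite [_ * (1 - F r) ^+ _]mulrC mulrA => <-.
congr (P _); apply/seteqP; split => w [].
  move=> /andP[fUw /forall_inP gtU] BJ; split => //= x /=; rewrite inE /B'.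
  case: ifP => [xJ _|_ /= xSU]; first exact: BJ.
  by rewrite in_itv /= andbT gtU.
move=> fUw BJ; split; last first.
  move=> x /= xJ; have := BJ x; rewrite /= /B' inE xJ; exact.
apply/andP; split => //; apply/forall_inP => x xSU.
have := BJ x; rewrite /= /B' inE xSU orbT (disjointFl dJSU xSU) => /(_ isT).
by rewrite /= in_itv /= andbT.
Qed.

Lemma measurable_stops_at (R : realType) (d : measure_display)
    (T : measurableType d) (I : finType) (X : I -> {mfun T >-> R})
    (l : nat -> R) (S U : {set I}) :
  measurable [set w | stops_at l (fun x => X x w) S U].
Proof.
rewrite (_ : [set w | _] = [set w | fully_fails l (fun x => X x w) U] `&`
    \bigcap_(x in [set x | x \in S :\: U]) X x @^-1` `]l #|U|.+1, +oo[).
  apply: measurableI; first exact: measurable_fully_fails.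
  apply: fin_bigcap_measurable => [|x _]; first exact: finite_finset.
  exact: (measurable_funPTI (X x) (measurable_itv _)).
apply/seteqP; split => w.
  move=> /andP[fU /forall_inP gtU]; split => // x /= /gtU.
  by rewrite in_itv /= andbT.
move=> [fU gtU]; apply/andP; split => //; apply/forall_inP => x /gtU /=.
by rewrite in_itv /= andbT.
Qed.

Lemma prob_bigcap (R : realType) (d : measure_display)
    (T : measurableType d) (P : probability T R) (I : finType)
    (X : I -> {RV P >-> R}) (J : {set I}) (B : I -> set R) (b : I -> R) :
  mutually_independent X -> (forall x, measurable (B x)) ->
  (forall x, P (X x @^-1` B x) = (b x)%:E) ->
  P (\bigcap_(x in [set x | x \in J]) (X x @^-1` B x)) = (\prod_(x in J) b x)%:E.
Proof.
move=> X_indep mB PB; rewrite X_indep // -prodEFin.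
by apply: eq_bigr => x _.
Qed.

(** Strong induction on #|S|: the sets U at which the cascade on S can stop
    partition the probability space, all proper subsets U are covered by the
    induction hypothesis, and the recursion for g leaves g #|S| for U = S.
    In particular the probability depends on #|S| only. *)
Lemma prob_fully_fails (R : realType) (d : measure_display)
    (T : measurableType d) (P : probability T R) (I : finType)
    (X : I -> {RV P >-> R}) (F : R -> R) (l g : nat -> R) (m : nat) :
  mutually_independent X ->
  (forall x r, cdf (X x) r = (F r)%:E) ->
  (forall i j, (1 <= i)%N -> (i <= j)%N -> (j <= #|I|)%N -> l i <= l j) ->
  (forall n, (n <= m)%N ->
     \sum_(j < n.+1) 'C(n, j)%:R * g j * (1 - F (l j.+1)) ^+ (n - j) = 1) ->
  forall S : {set I}, (#|S| <= m)%N -> fails_indep X l S (g #|S|).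
Proof.
move=> X_indep X_cdf l_incr g_rec S.
have [k] := ubnP #|S|; elim: k S => // k IHk S; rewrite ltnS => S_le S_m.
move=> J B b dJS mB PB.
set G := \bigcap_(x in _) _.
have mG : measurable G.
  apply: fin_bigcap_measurable => [|x _]; first exact: finite_finset.
  exact: (measurable_funPTI (X x) (mB x)).
have PG : P G = (\prod_(x in J) b x)%:E by exact: prob_bigcap.
have l_incrS i j : (1 <= i)%N -> (i <= j)%N -> (j <= #|S|)%N -> l i <= l j.
  by move=> i1 ij jS; apply: l_incr => //; exact: leq_trans jS (max_card _).
pose E U := [set w | stops_at l (fun x => X x w) S U] `&` G.
have E_S : E S = [set w | fully_fails l (fun x => X x w) S] `&` G.
  apply/seteqP; split => w [/= fS Gw]; split => //; first by case/andP: fS.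
  by apply/andP; split => //; apply/forall_inP => x; rewrite finset.setDv inE.
have G_E : G = \bigcup_(U in [set U : {set I} | U \subset S]) E U.
  apply/seteqP; split => [w Gw|w [U _ []]//].
  have [U US sU] := stops_at_exists (fun x => X x w) l_incrS.
  by exists U.
have := PG; rewrite {1}G_E measure_finType_bigcup; first last.
- by move=> U V w US VS [sU _] [sV _]; exact: (stops_at_uniq l_incrS US VS sU sV).
- by move=> U _; apply: measurableI => //; exact: measurable_stops_at.
rewrite (bigD1 S) //= -E_S.
pose h j := g j * (1 - F (l j.+1)) ^+ (#|S| - j).
rewrite (eq_bigr (fun U : {set I} => (h #|U| * \prod_(x in J) b x)%:E)); last first.
  move=> U /andP[US UneS].
  have ltUS : (#|U| < #|S|)%N by rewrite proper_card // finset.properEneq UneS.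
  apply: (prob_stops_at X_cdf US _ dJS mB PB).
  apply: IHk; first exact: leq_trans ltUS S_le.
  exact: leq_trans (ltnW ltUS) S_m.
rewrite sumEFin -mulr_suml.
have -> : \sum_(U : {set I} | (U \subset S) && (U != S)) h #|U| = 1 - g #|S|.
  have := sum_subsets_by_card S h.
  rewrite (bigD1 S) //= => /(canRL (addKr _)) ->.
  rewrite {1}/h subnn expr0 mulr1 addrC; congr (_ - _).
  rewrite -(g_rec _ S_m); apply: eq_bigr => j _.
  by rewrite -[LHS]mulr_natl mulrA.
move/(congr1 (fun y => y - ((1 - g #|S|) * \prod_(x in J) b x)%:E)%E).
by rewrite addeK // => ->; rewrite -EFinB; congr (_%:E); ring.
Qed.

Lemma prob_blackout_ge (R : realType) (d : measure_display)
    (T : measurableType d) (P : probability T R) (N : nat)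
    (X : 'I_N -> {RV P >-> R}) (F : R -> R) (l g : nat -> R) (k : nat) :
  mutually_independent X ->
  (forall x r, cdf (X x) r = (F r)%:E) ->
  (forall i j, (1 <= i)%N -> (i <= j)%N -> (j <= N)%N -> l i <= l j) ->
  (k <= N)%N ->
  (forall n, (n < k)%N ->
     \sum_(j < n.+1) 'C(n, j)%:R * g j * (1 - F (l j.+1)) ^+ (n - j) = 1) ->
  P [set w | (k <= blackout_size l (fun x => X x w))%N]
  = (1 - \sum_(j < k) 'C(N, j)%:R * g j * (1 - F (l j.+1)) ^+ (N - j))%:E.
Proof.
move=> X_indep X_cdf l_incr kN g_rec.
case: k => [|k] in kN g_rec *.
  by rewrite big_ord0 subr0 (_ : [set w | _] = setT) ?probability_setT //; apply/seteqP.
have l_incr' i j : (1 <= i)%N -> (i <= j)%N -> (j <= #|'I_N|)%N -> l i <= l j.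
  by rewrite card_ord; exact: l_incr.
pose E U := [set w | stops_at l (fun x => X x w) [set: 'I_N] U].
have mE U : measurable (E U) by exact: measurable_stops_at.
have -> : [set w | (k < blackout_size l (fun x => X x w))%N] =
    ~` \bigcup_(U in [set U : {set 'I_N} | (#|U| < k.+1)%N]) E U.
  apply/seteqP; split => w /=.
    by move=> kw [U /= Uk /blackout_size_stops_at Uw]; rewrite Uw ltnNge -ltnS Uk in kw.
  have [|U _ sU] := @stops_at_exists _ _ l (fun x => X x w) [set: 'I_N].
    by rewrite cardsT.
  rewrite (blackout_size_stops_at sU) => nE; rewrite ltnNge; apply/negP => Uk.
  by apply: nE; exists U.
rewrite probability_setC; last by apply: fin_bigcup_measurable => // ; exact: finite_finset.
rewrite measure_finType_bigcup //; last first.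
  by move=> U V w _ _; apply: stops_at_uniq; rewrite ?finset.subsetT // cardsT.
pose h j := g j * (1 - F (l j.+1)) ^+ (N - j).
rewrite (eq_bigr (fun U : {set 'I_N} => (h #|U|)%:E)); last first.
  move=> U Uk.
  have fU : fails_indep X l U (g #|U|) by exact: (prob_fully_fails X_indep X_cdf l_incr' g_rec).
  have d0 : [disjoint (finset.set0 : {set 'I_N}) & [set: 'I_N]%SET]%B
    by rewrite disjoint_subset; apply/fintype.subsetP => x; rewrite inE.
  have := prob_stops_at X_cdf (finset.subsetT U) fU d0 (fun=> measurableT)
    (fun x => probability_setT P).
  by rewrite big_set0 mulr1 cardsT card_ord => <-; congr (P _); apply/seteqP; split => [w|w []//];
    split => // x; rewrite /= inE.
rewrite sumEFin -EFinB; congr ((1 - _)%:E).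
rewrite (big_ord_widen N.+1 (fun j => 'C(N, j)%:R * g j * (1 - F (l j.+1)) ^+ (N - j)));
  last exact: ltnW.
transitivity (\sum_(U : {set 'I_N} | U \subset [set: 'I_N]%SET)
    (if (#|U| < k.+1)%N then h #|U| else 0)).
  rewrite -big_mkcondr; apply: eq_bigl => U; by rewrite finset.subsetT.
rewrite (sum_subsets_by_card [set: 'I_N] (fun j => if (j < k.+1)%N then h j else 0)).
rewrite cardsT card_ord [RHS]big_mkcond; apply: eq_bigr => j _.
by case: ifP => _; [rewrite /h -[LHS]mulr_natl mulrA|rewrite mul0rn].
Qed.

(** * Wallis' product *)

Lemma is_derive_ge0_le (R : realType) (f df : R -> R) (a b : R) :
  a <= b ->
  (forall x, a <= x <= b -> is_derive x 1 f (df x)) ->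
  (forall x, a <= x <= b -> 0 <= df x) -> f a <= f b.
Proof.
move=> ab fdf df_ge0.
have [||x xab E] := @MVT_segment R f df a b ab.
- by move=> x; rewrite in_itv /= => /andP[/ltW ax /ltW xb]; apply: fdf; rewrite ax.
- apply: derivable_within_continuous => x; rewrite in_itv /= => xab.
  by have [] := fdf x xab.
by rewrite -subr_ge0 E mulr_ge0 ?subr_ge0 // df_ge0 //; rewrite in_itv in xab.
Qed.

(** The antiderivative of cos^n that vanishes at 0. *)
Fixpoint cos_pow_prim (R : realType) (n : nat) (x : R) {struct n} : R :=
  match n with
  | 0 => x
  | 1 => sin x
  | (m.+1 as m').+1 =>
      (cos x ^+ m' * sin x + m'%:R * cos_pow_prim m x) / m'.+1%:R
  end.

(** The reduction formula for the integral of cos^n, in differentiated form. *)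
Lemma is_derive_cos_pow_prim (R : realType) (n : nat) (x : R) :
  is_derive x 1 (cos_pow_prim n) (cos x ^+ n).
Proof.
suff : is_derive x 1 (cos_pow_prim n : R -> R) (cos x ^+ n) /\
       is_derive x 1 (cos_pow_prim n.+1 : R -> R) (cos x ^+ n.+1) by case.
elim: n => [|n [IHn IHn1]].
  by rewrite expr0 expr1; split; [exact: is_derive_id | exact: is_derive_sin].
split=> //.
have dF := is_deriveZ n.+2%:R^-1
  (is_deriveD (is_deriveM (is_deriveX n.+1 (is_derive_cos x)) (is_derive_sin x))
              (is_deriveZ n.+1%:R IHn)).
have -> : cos_pow_prim n.+2 = (n.+2%:R^-1 : R) \*:
    ((@cos R) ^+ n.+1 * (@sin R) + (n.+1%:R : R) \*: cos_pow_prim n).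
  apply/funext => y.
  by rewrite /= mulrC; congr (_ * (_ * _ + _)); rewrite exprfctE.
apply: (is_derive_eq dF).
rewrite exprfctE /GRing.scale /=.
apply: (@mulfI _ n.+2%:R); first by rewrite pnatr_eq0.
rewrite [LHS]mulrA mulfV ?pnatr_eq0 // mul1r.
have := cos2Dsin2 x; move: (cos x) (sin x) => c s /(canRL (addKr _)) s2.
transitivity (c ^+ n.+1 * c - n.+1%:R * c ^+ n * s ^+ 2 + n.+1%:R * c ^+ n).
  by ring.
by rewrite s2 !exprS -[n.+2]addn1 natrD; ring.
Qed.

(** The integral of cos^n over the interval from 0 to pi / 2. *)
Definition wallis (R : realType) (n : nat) : R := cos_pow_prim n (pi / 2).

Lemma wallisSS (R : realType) (n : nat) :
  wallis R n.+2 = n.+1%:R / n.+2%:R * wallis R n.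
Proof.
by rewrite /wallis /= cos_pihalf expr0n /= mul0r add0r mulrAC.
Qed.

Lemma wallis_gt0 (R : realType) (n : nat) : 0 < wallis R n.
Proof.
suff /andP[] : (0 < wallis R n) && (0 < wallis R n.+1) by [].
elim: n => [|n /andP[W0 W1]].
  by rewrite /wallis /= sin_pihalf ltr01 divr_gt0 ?pi_gt0.
by rewrite W1 wallisSS mulr_gt0 // divr_gt0 ?ltr0n.
Qed.

Lemma wallis_decr (R : realType) (n : nat) : wallis R n.+1 <= wallis R n.
Proof.
have prim0 m : cos_pow_prim m (0 : R) = 0.
  suff [] : cos_pow_prim m (0 : R) = 0 /\ cos_pow_prim m.+1 (0 : R) = 0 by [].
  elim: m => [|m [IH0 IH1]]; first by rewrite /= sin0.
  by split=> //=; rewrite IH0 sin0 !mulr0 addr0 mul0r.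
rewrite -subr_ge0.
pose f := cos_pow_prim n - cos_pow_prim n.+1 : R -> R.
have f0 : f 0 = 0.
  by rewrite -[f 0]/(cos_pow_prim n 0 - cos_pow_prim n.+1 0) !prim0 subr0.
suff : f 0 <= f (pi / 2) by rewrite f0.
apply: (@is_derive_ge0_le _ f (fun x => cos x ^+ n - cos x ^+ n.+1)).
- by rewrite divr_ge0 ?pi_ge0.
- move=> x _; exact: is_deriveB (is_derive_cos_pow_prim n x) (is_derive_cos_pow_prim n.+1 x).
move=> x /andP[x0 xpi].
have cx : 0 <= cos x.
  by apply: cos_ge0_pihalf; rewrite xpi andbT (le_trans _ x0) // oppr_le0 divr_ge0 ?pi_ge0.
by rewrite subr_ge0 exprS ler_piMl ?exprn_ge0 // cos_le1.
Qed.

Lemma wallis_prod (R : realType) (n : nat) :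
  n.+1%:R * wallis R n.+1 * wallis R n = pi / 2.
Proof.
elim: n => [|n IHn]; first by rewrite /wallis /= sin_pihalf !mul1r.
rewrite wallisSS -[RHS]IHn.
have : n.+2%:R != 0 :> R by rewrite pnatr_eq0.
by move: n.+2%:R => a a0; field.
Qed.

Lemma wallis_even (R : realType) (n : nat) :
  wallis R n.*2 = pi / 2 * ('C(n.*2, n)%:R / 4 ^+ n).
Proof.
elim: n => [|n IHn]; first by rewrite /wallis bin0 expr0 divr1 mulr1.
rewrite doubleS wallisSS IHn.
have E : 'C(n.*2.+2, n.+1)%:R * n.+1%:R = 2 * n.*2.+1%:R * 'C(n.*2, n)%:R :> R.
  rewrite -!natrM; congr (_%:R).
  have E1 := mul_bin_diag n.*2.+2 n.
  have E2 := mul_bin_down n.*2.+1 n.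
  rewrite /= (_ : (n.*2.+1 - n = n.+1)%N) in E1 E2; last by lia.
  have := mul_bin_diag n.*2.+1 n.
  nia.
have -> : 'C(n.*2.+2, n.+1)%:R = 2 * n.*2.+1%:R * 'C(n.*2, n)%:R / n.+1%:R :> R.
  by rewrite -E mulfK // pnatr_eq0.
have -> : n.*2.+2%:R = 2 * n.+1%:R :> R by rewrite -natrM -doubleS -mul2n.
rewrite exprS.
have : n.+1%:R != 0 :> R by rewrite pnatr_eq0.
have : (4 : R) ^+ n != 0 by rewrite expf_neq0 // pnatr_eq0.
by move: n.+1%:R (4 ^+ n) n.*2.+1%:R => a b c a0 b0; field; rewrite a0 b0.
Qed.

(** * Stirling's formula *)

(** The products n W_n W_(n-1) of consecutive Wallis integrals all equal pi / 2,
    so by monotonicity (2 n + 1) W_(2n)^2 and 2 n W_(2n)^2 enclose pi / 2. *)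
Lemma cvg_central_binomial (R : realType) :
  n%:R * ('C(n.*2, n)%:R / 4 ^+ n) ^+ 2 @[n --> \oo] --> (pi : R)^-1.
Proof.
have pi0 : 0 < pi :> R := pi_gt0 R.
rewrite -cvg_shiftS /=.
apply: (@squeeze_cvgr _ _ _ _ (fun n => pi^-1 * (1 - harmonic n)) (fun=> pi^-1)); last 2 first.
- rewrite -[X in _ --> X](mulr1 (pi^-1)) -[X in _ * X](subr0 1).
  apply: cvgM; first exact: cvg_cst.
  by apply: cvgB; [exact: cvg_cst | exact: cvg_harmonic].
- exact: cvg_cst.
near=> n; rewrite /harmonic.
have n0 : 0 < n.+1%:R :> R by rewrite ltr0n.
set x : R := n.+1%:R in n0 *; set c : R := _ / _.
have Wc : wallis R n.+1.*2 = pi / 2 * c by exact: wallis_even.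
have W0 := wallis_gt0 R n.+1.*2.
have x2 : n.+1.*2%:R = 2 * x :> R by rewrite -natrM mul2n.
(* Compare W_(2n) with its neighbours W_(2n+1) and W_(2n-1). *)
have lo : pi / 2 <= (2 * x + 1) * wallis R n.+1.*2 ^+ 2.
  rewrite -(wallis_prod R n.+1.*2) -[n.+1.*2.+1%:R]natr1 x2 -mulrA expr2.
  by rewrite ler_pM2l ?ler_pM2r ?wallis_decr //; lra.
have hi : 2 * x * wallis R n.+1.*2 ^+ 2 <= pi / 2.
  rewrite -x2 -(wallis_prod R n.*2.+1) -doubleS -mulrA expr2.
  by rewrite ler_pM2l ?ler_pM2l ?wallis_decr // x2; lra.
rewrite Wc in lo hi.
have {}lo : 2 <= (2 * x + 1) * pi * c ^+ 2.
  rewrite -(ler_pM2l (_ : 0 < pi / 4)) ?divr_gt0 //.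
  suff -> : pi / 4 * ((2 * x + 1) * pi * c ^+ 2) = (2 * x + 1) * (pi / 2 * c) ^+ 2 by lra.
  by field.
have {}hi : x * pi * c ^+ 2 <= 1.
  rewrite -(ler_pM2l (_ : 0 < pi / 2)) ?divr_gt0 // mulr1.
  suff -> : pi / 2 * (x * pi * c ^+ 2) = 2 * x * (pi / 2 * c) ^+ 2 by [].
  by field.
have picc : pi * (x * c ^+ 2) = x * pi * c ^+ 2 by ring.
apply/andP; split; rewrite -(ler_pM2l pi0) picc; last by rewrite divff ?gt_eqF.
rewrite mulrA divff ?gt_eqF // mul1r.
rewrite lerBlDr -(ler_pM2l n0) mulrDr divff ?gt_eqF // mulr1.
have c2 : 0 <= c ^+ 2 by rewrite sqr_ge0.
have : 2 * x <= x * (2 * x + 1) * pi * c ^+ 2.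
  by have := ler_wpM2l (ltW n0) lo; rewrite !mulrA [x * 2]mulrC.
nra.
Unshelve. all: by end_near. Qed.

(** This bound and the next one enclose ln u with an error of third order in
    u - 1.  For u = (n + 2) / (n + 1) they show that the Stirling ratio
    decreases and that its decrease is summable. *)
Lemma ln_ge_homographic (R : realType) (u : R) : 1 <= u -> 2 - 4 / (u + 1) <= ln u.
Proof.
move=> u1.
pose f : R -> R := (@ln R) + 4 \*: (fun x => (x + 1)^-1).
suff : f 1 <= f u.
  rewrite -[f 1]/(ln 1 + 4 * (1 + 1)^-1) -[f u]/(ln u + 4 * (u + 1)^-1) ln1.
  have -> : 4 * (1 + 1)^-1 = 2 :> R by field.
  by move: (u + 1)^-1 => v; lra.
apply: (@is_derive_ge0_le _ f (fun x => x^-1 + 4 *: (- (x + 1) ^- 2 *: (1 + 0)))) => //.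
  move=> x /andP[x1 _]; apply: is_deriveD.
    by apply: is_derive1_ln; lra.
  apply: is_deriveZ.
  by apply: (is_deriveV (f := fun y : R => y + 1)); rewrite gt_eqF //; lra.
move=> x /andP[x1 _]; rewrite /GRing.scale /=.
have -> : x^-1 + 4 * (- (x + 1) ^- 2 * (1 + 0)) = (x - 1) ^+ 2 / (x * (x + 1) ^+ 2).
  by field; rewrite !gt_eqF //; lra.
by rewrite divr_ge0 ?sqr_ge0 // mulr_ge0 ?sqr_ge0 //; lra.
Qed.

Lemma ln_le_trapezoid (R : realType) (u : R) : 1 <= u -> ln u <= (u - u^-1) / 2.
Proof.
move=> u1.
pose f : R -> R := 2^-1 \*: (id - (fun x => x^-1)) - (@ln R).
suff : f 1 <= f u.
  rewrite -[f 1]/(2^-1 * (1 - 1^-1) - ln 1) -[f u]/(2^-1 * (u - u^-1) - ln u) ln1.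
  by rewrite invr1; lra.
apply: (@is_derive_ge0_le _ f (fun x => 2^-1 *: (1 - (- x ^- 2 *: 1)) - x^-1)) => //.
  move=> x /andP[x1 _]; apply: is_deriveB.
    apply: is_deriveZ; apply: is_deriveB.
    by apply: (is_deriveV (f := fun y : R => y)); rewrite gt_eqF //; lra.
  by apply: is_derive1_ln; lra.
move=> x /andP[x1 _]; rewrite /GRing.scale /=.
have -> : 2^-1 * (1 - (- x ^- 2 * 1)) - x^-1 = (x - 1) ^+ 2 / (2 * x ^+ 2).
  by field; rewrite gt_eqF //; lra.
by rewrite divr_ge0 ?sqr_ge0 // mulr_ge0 ?sqr_ge0 //; lra.
Qed.

(** At n = 0 the quotient is 0 by the convention for division by 0; only large
    n matter. *)
Definition stirling_ratio (R : realType) (n : nat) : R :=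
  n`!%:R * expR n%:R / (n%:R ^+ n * Num.sqrt n%:R).

Definition ln_stirling_ratio (R : realType) (n : nat) : R :=
  ln n`!%:R + n%:R - (n%:R + 2^-1) * ln n%:R.

Lemma stirling_ratioE (R : realType) (n : nat) :
  (0 < n)%N -> stirling_ratio R n = expR (ln_stirling_ratio R n).
Proof.
move=> n0; have x0 : 0 < n%:R :> R by rewrite ltr0n.
rewrite /ln_stirling_ratio expRB expRD lnK ?posrE ?ltr0n ?fact_gt0 //.
rewrite mulrDl expRD expRM_natl lnK ?posrE //.
congr (_ / (_ * _)).
rewrite -[LHS](ger0_norm (sqrtr_ge0 _)) -[RHS]ger0_norm ?expR_ge0 // -!sqrtr_sqr.
rewrite sqr_sqrtr ?ltW // -expRM_natl mulrA divff ?pnatr_eq0 // mul1r lnK //.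
Qed.

Lemma ln_stirling_ratio_step (R : realType) (n : nat) :
  0 <= ln_stirling_ratio R n.+1 - ln_stirling_ratio R n.+2
    <= (4 * n.+1%:R)^-1 - (4 * n.+2%:R)^-1.
Proof.
have x0 : 0 < n.+1%:R :> R by rewrite ltr0n.
have x1 : n.+2%:R = n.+1%:R + 1 :> R by rewrite natr1.
pose u : R := n.+2%:R / n.+1%:R.
have u1 : 1 <= u by rewrite /u ler_pdivlMr // mul1r x1; lra.
have -> : ln_stirling_ratio R n.+1 - ln_stirling_ratio R n.+2
    = (n.+1%:R + 2^-1) * ln u - 1.
  rewrite /ln_stirling_ratio /u ln_div ?posrE ?ltr0n // [n.+2`!]factS natrM.
  rewrite lnM ?posrE ?ltr0n ?fact_gt0 //.
  by move: (ln _) (ln _) (ln _) => a b c; rewrite x1; ring.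
have lo := ln_ge_homographic u1; have hi := ln_le_trapezoid u1.
have uE : 2 - 4 / (u + 1) = (n.+1%:R + 2^-1)^-1.
  by rewrite /u x1; move: (n.+1%:R : R) x0 => x x0; field; rewrite !gt_eqF //; lra.
have uE' : (u - u^-1) / 2 = (1 + ((4 * n.+1%:R)^-1 - (4 * n.+2%:R)^-1)) / (n.+1%:R + 2^-1).
  by rewrite /u x1; move: (n.+1%:R : R) x0 => x x0; field; rewrite !gt_eqF //; lra.
have y0 : 0 < n.+1%:R + 2^-1 :> R by lra.
rewrite uE in lo; rewrite uE' in hi.
apply/andP; split.
  by rewrite subr_ge0 -ler_pdivrMl // mulr1.
by rewrite lerBlDl -ler_pdivlMl // mulrC.
Qed.

(** The logarithm a n decreases, while a n - 1 / (4 (n + 1)) increases. *)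
Lemma cvg_stirling_ratio_gt0 (R : realType) :
  exists2 L : R, 0 < L & stirling_ratio R n @[n --> \oo] --> L.
Proof.
pose a n := ln_stirling_ratio R n.+1.
have a_decr : nonincreasing_seq a.
  apply/nonincreasing_seqP => n; rewrite -subr_ge0.
  by have /andP[] := ln_stirling_ratio_step R n.
have a_lb n : a 0 - 4^-1 <= a n.
  suff : a 0 - 4^-1 <= a n - (4 * n.+1%:R)^-1.
    by move/le_trans; apply; rewrite gerBl invr_ge0 mulr_ge0.
  elim: n => [|n IHn]; first by rewrite mulr1.
  apply: le_trans IHn _.
  have /andP[_] := ln_stirling_ratio_step R n; rewrite /a.
  by move: (4 * n.+1%:R)^-1 (4 * n.+2%:R)^-1 => p q step; lra.
have a_cvg : cvgn a.
  apply: nonincreasing_is_cvgn => //.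
  by exists (a 0 - 4^-1) => _ [n _ <-].
exists (expR (limn a)); first exact: expR_gt0.
rewrite -cvg_shiftS /=.
under eq_cvg do rewrite stirling_ratioE //.
by apply: continuous_cvg => //; exact: continuous_expR.
Qed.

(** The limit L satisfies L / L^2 = 1 / sqrt(2 pi), since the ratio at 2 n
    divided by the square of the ratio at n is a central binomial coefficient
    up to elementary factors.  Here L > 0 allows the division. *)
Lemma cvg_stirling_ratio (R : realType) :
  stirling_ratio R n @[n --> \oo] --> Num.sqrt (2 * pi).
Proof.
have [L L0 sL] := cvg_stirling_ratio_gt0 R.
have double_oo : n.*2 @[n --> \oo] --> \oo.
  by apply/cvgnyPge => A; near=> n; rewrite -addnn (leq_trans _ (leq_addr _ _)) //;
     near: n; exact: nbhs_infty_ge.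
have s2L : stirling_ratio R n.*2 @[n --> \oo] --> L by exact: cvg_comp double_oo sL.
have lim1 : (stirling_ratio R n.*2 / stirling_ratio R n ^+ 2) ^+ 2 @[n --> \oo]
    --> (L / L ^+ 2) ^+ 2.
  have cM : stirling_ratio R n.*2 / stirling_ratio R n ^+ 2 @[n --> \oo] --> L / L ^+ 2.
    apply: cvgM => //; apply: cvgV; first by rewrite expf_neq0 // gt_eqF.
    exact: cvgM.
  exact: cvgM.
have lim2 : (stirling_ratio R n.*2 / stirling_ratio R n ^+ 2) ^+ 2 @[n --> \oo]
    --> (2 * pi : R)^-1.
  have H : 2^-1 * (n%:R * ('C(n.*2, n)%:R / 4 ^+ n) ^+ 2) @[n --> \oo] --> (2^-1 / pi : R).
    by apply: cvgM; [exact: cvg_cst | exact: cvg_central_binomial].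
  rewrite invfM; apply: (cvg_trans _ H); apply: near_eq_cvg; near=> n.
  have n0 : (0 < n)%N by near: n; exact: nbhs_infty_ge.
  have x0 : 0 < n%:R :> R by rewrite ltr0n.
  have facE : n.*2`!%:R = 'C(n.*2, n)%:R * n`!%:R ^+ 2 :> R.
    by rewrite expr2 -!natrM -addnn -(bin_fact (leq_addr n n)) addnK.
  have sqE : Num.sqrt n.*2%:R = Num.sqrt 2 * Num.sqrt n%:R :> R.
    by rewrite -mul2n natrM sqrtrM.
  have x2 : n.*2%:R = 2 * n%:R :> R by rewrite -mul2n natrM.
  rewrite /stirling_ratio facE sqE x2 expRM_natl -mul2n
    [(2 * n%:R) ^+ _]exprMn 2!exprM [(n%:R ^+ 2) ^+ n]exprAC.
  rewrite (_ : 2 ^+ 2 = 4 :> R); last by rewrite -natrX.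
  have s20 : Num.sqrt 2 != 0 :> R by rewrite gt_eqF // sqrtr_gt0.
  have sx0 : Num.sqrt n%:R != 0 :> R by rewrite gt_eqF // sqrtr_gt0.
  have e0 : expR n%:R != 0 :> R by rewrite gt_eqF // expR_gt0.
  have p0 : (4 : R) ^+ n != 0 by rewrite expf_neq0 // pnatr_eq0.
  have f0 : n`!%:R != 0 :> R by rewrite pnatr_eq0 -lt0n fact_gt0.
  have q0 : (n%:R : R) ^+ n != 0 by rewrite expf_neq0 // gt_eqF.
  have sqx : n%:R = Num.sqrt n%:R ^+ 2 :> R by rewrite sqr_sqrtr // ltW.
  have sq2 : 2^-1 = (Num.sqrt 2 ^+ 2)^-1 :> R by rewrite sqr_sqrtr.
  rewrite [X in _ * (X * _)]sqx sq2.
  move: (Num.sqrt 2) (Num.sqrt n%:R) (expR n%:R) (4 ^+ n) (n`!%:R) (n%:R ^+ n)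
    'C(2 * n, n)%:R s20 sx0 e0 p0 f0 q0 => r t e p f q C r0 t0 e0 p0 f0 q0.
  by field; rewrite r0 t0 e0 p0 f0 q0.
have L2 : L ^+ 2 = 2 * pi.
  have E : (L / L ^+ 2) ^+ 2 = (2 * pi)^-1 by exact: cvg_unique lim1 lim2.
  by rewrite -[RHS]invrK -E; field; rewrite gt_eqF.
by rewrite -L2 sqrtr_sqr ger0_norm // ltW.
Unshelve. all: by end_near. Qed.

(** * The local limit *)

Lemma cvg_natV (R : realType) : (n%:R : R)^-1 @[n --> \oo] --> 0.
Proof. by rewrite -cvg_shiftS; exact: cvg_harmonic. Qed.

(** With y = x / n, apply 1 + t <= expR t to t = y and to t = - y / (1 + y). *)
Lemma cvg_1DxVn_expR (R : realType) (x : R) :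
  (1 + x * n%:R^-1) ^+ n @[n --> \oo] --> expR x.
Proof.
have cvg_1D : 1 + x * n%:R^-1 @[n --> \oo] --> (1 : R).
  rewrite -[X in _ --> X]addr0 -[X in _ --> _ + X](mulr0 x).
  by apply: cvgD; [exact: cvg_cst | apply: cvgM; [exact: cvg_cst | exact: cvg_natV]].
apply: (@squeeze_cvgr _ _ _ _ (fun n => expR (x / (1 + x * n%:R^-1))) (fun=> expR x)).
- near=> n.
  have n0 : (0 < n)%N by near: n; exact: nbhs_infty_ge.
  have y0 : 0 < 1 + x * n%:R^-1 by near: n; apply: (cvgr_gt 1 cvg_1D).
  move: y0; set y := x * n%:R^-1 => y0.
  have xE : x = n%:R * y by rewrite /y mulrC mulfVK // pnatr_eq0 -lt0n.
  rewrite xE -mulrA !expRM_natl; apply/andP; split; last first.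
    by rewrite lerXn2r ?nnegrE ?expR_ge0 ?(ltW y0) // expR_ge1Dx.
  rewrite lerXn2r ?nnegrE ?expR_ge0 ?(ltW y0) //.
  rewrite -lef_pV2 ?posrE ?expR_gt0 // -expRN.
  have {1}-> : (1 + y)^-1 = 1 + - (y / (1 + y)) by field; rewrite gt_eqF.
  exact: expR_ge1Dx.
- apply: continuous_cvg; first exact: continuous_expR.
  rewrite -[X in _ --> X]divr1.
  by apply: cvgM; [exact: cvg_cst | apply: cvgV].
- exact: cvg_cst.
Unshelve. all: by end_near. Qed.

(** The probability of exactly j failures when theta + j <= N.  Beyond that
    range it is defined by the same formula, with a possibly negative value. *)
Definition failure_pmf (R : realType) (theta : R) (N j : nat) : R :=
  'C(N, j)%:R * abel_poly theta j * (N%:R - theta - j%:R) ^+ (N - j) / N%:R ^+ N.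

(** The asymptotic value of the probability of at least j failures. *)
Definition tail_approx (R : realType) (theta : R) (N j : nat) : R :=
  2 * theta / Num.sqrt (2 * pi) * Num.sqrt ((N%:R - j%:R) / (j%:R * N%:R)).

(** The quotient of [failure_pmf] by the increment of [tail_approx], for j
    failures and m = N - j surviving lines, composed of functions
    of j alone, of m alone and of j + m alone. *)
Definition local_ratio (R : realType) (theta : R) (j m : nat) : R :=
  Num.sqrt (2 * pi)
  * (stirling_ratio R (j + m) / (stirling_ratio R j * stirling_ratio R m))
  * ((1 + theta * j%:R^-1) ^+ j * (1 - theta * m%:R^-1) ^+ m)
  * ((1 + j%:R^-1) / (1 + theta * j%:R^-1))
  * ((1 + Num.sqrt (1 - m%:R^-1) * Num.sqrt (1 - j.+1%:R^-1)) / 2).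

Lemma cvg_local_ratio (R : realType) (theta : R) :
  local_ratio theta z.1 z.2 @[z --> (\oo, \oo)] --> (1 : R).
Proof.
have c1 : z.1 @[z --> (\oo, \oo)] --> \oo by exact: cvg_fst.
have c2 : z.2 @[z --> (\oo, \oo)] --> \oo by exact: cvg_snd.
have c12 : (z.1 + z.2)%N @[z --> (\oo, \oo)] --> \oo.
  apply/cvgnyPge => A; near=> z; apply: leq_trans (leq_addr _ _).
  by near: z; exact: (c1 _ (nbhs_infty_ge A)).
pose L : R := Num.sqrt (2 * pi).
have L0 : L != 0 by rewrite gt_eqF // sqrtr_gt0 mulr_gt0 // pi_gt0.
have -> : (1 : R) = L * (L / (L * L)) * (expR theta * expR (- theta))
    * ((1 + 0) / (1 + theta * 0))
    * ((1 + Num.sqrt (1 - 0) * Num.sqrt (1 - 0)) / 2).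
  rewrite expRxMexpNx_1 subr0 sqrtr1 addr0 mulr0 addr0.
  by field.
have cV (f : nat * nat -> nat) : f z @[z --> (\oo, \oo)] --> \oo ->
    (f z)%:R^-1 @[z --> (\oo, \oo)] --> (0 : R).
  by move=> cf; apply: cvg_comp cf (@cvg_natV R).
have cs (f : nat * nat -> nat) : f z @[z --> (\oo, \oo)] --> \oo ->
    stirling_ratio R (f z) @[z --> (\oo, \oo)] --> L.
  by move=> cf; apply: cvg_comp cf (@cvg_stirling_ratio R).
have csqrt (f : nat * nat -> nat) : f z @[z --> (\oo, \oo)] --> \oo ->
    Num.sqrt (1 - (f z)%:R^-1) @[z --> (\oo, \oo)] --> Num.sqrt (1 - 0 : R).
  move=> cf; apply: continuous_cvg; first exact: sqrt_continuous.
  by apply: cvgB; [exact: cvg_cst | exact: cV].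
have c1S : z.1.+1 @[z --> (\oo, \oo)] --> \oo.
  apply/cvgnyPge => A; near=> z; apply: leq_trans (leqnSn _).
  by near: z; exact: (c1 _ (nbhs_infty_ge A)).
apply: cvgM; first apply: cvgM; first apply: cvgM; first apply: cvgM.
- exact: cvg_cst.
- apply: cvgM; first exact: cs.
  by apply: cvgV; [rewrite mulf_neq0 | apply: cvgM; exact: cs].
- apply: cvgM; first exact: (cvg_comp _ _ c1 (@cvg_1DxVn_expR R theta)).
  have := cvg_comp _ _ c2 (@cvg_1DxVn_expR R (- theta)).
  by under eq_cvg do rewrite /= mulNr.
- apply: cvgM; first by apply: cvgD; [exact: cvg_cst | exact: cV].
  apply: cvgV; first by rewrite mulr0 addr0 oner_neq0.
  by apply: cvgD; [exact: cvg_cst | apply: cvgM; [exact: cvg_cst | exact: cV]].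
- apply: cvgM; last exact: cvg_cst.
  apply: cvgD; first exact: cvg_cst.
  by apply: cvgM; exact: csqrt.
Unshelve. all: by end_near. Qed.

Lemma failure_pmfE (R : realType) (theta : R) (j m : nat) :
  0 < theta -> (0 < j)%N -> (0 < m)%N ->
  failure_pmf theta (j + m) j =
    theta / (theta + j%:R)
    * (stirling_ratio R (j + m) / (stirling_ratio R j * stirling_ratio R m))
    * (Num.sqrt (j + m)%:R / (Num.sqrt j%:R * Num.sqrt m%:R))
    * ((1 + theta * j%:R^-1) ^+ j * (1 - theta * m%:R^-1) ^+ m).
Proof.
move=> th0 j0 m0.
have J0 : 0 < j%:R :> R by rewrite ltr0n.
have M0 : 0 < m%:R :> R by rewrite ltr0n.
have N0 : 0 < (j + m)%:R :> R by rewrite ltr0n addn_gt0 j0.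
rewrite /failure_pmf /stirling_ratio addnC addnK addnC.
have -> : (j + m)%:R - theta - j%:R = m%:R - theta :> R by rewrite natrD; ring.
have -> : abel_poly theta j = theta * (theta + j%:R) ^+ j / (theta + j%:R).
  case: j j0 J0 {N0} => // j _ J0; rewrite /= exprSr mulrA mulfK //.
  by rewrite gt_eqF // addr_gt0.
have -> : (theta + j%:R) ^+ j = j%:R ^+ j * (1 + theta * j%:R^-1) ^+ j.
  by rewrite -exprMn; congr (_ ^+ _); field; rewrite gt_eqF.
have -> : (m%:R - theta) ^+ m = m%:R ^+ m * (1 - theta * m%:R^-1) ^+ m.
  by rewrite -exprMn; congr (_ ^+ _); field; rewrite gt_eqF.
have -> : 'C(j + m, j)%:R = (j + m)`!%:R / (j`!%:R * m`!%:R) :> R.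
  apply: (canRL (mulfK _)); first by rewrite mulf_neq0 // pnatr_eq0 -lt0n fact_gt0.
  by rewrite -!natrM -(bin_fact (leq_addr m j)) addKn.
have -> : expR (j + m)%:R = expR j%:R * expR m%:R :> R by rewrite natrD expRD.
have tJ0 : theta + j%:R != 0 by rewrite gt_eqF // addr_gt0.
have neq0E : [/\ expR j%:R != 0 :> R, expR m%:R != 0 :> R,
    Num.sqrt j%:R != 0 :> R, Num.sqrt m%:R != 0 :> R & Num.sqrt (j + m)%:R != 0 :> R].
  by split; rewrite gt_eqF ?expR_gt0 ?sqrtr_gt0.
have [eJ eM aJ aM aN] := neq0E.
have [fJ fM fN] : [/\ j`!%:R != 0 :> R, m`!%:R != 0 :> R & (j + m)`!%:R != 0 :> R].
  by split; rewrite pnatr_eq0 -lt0n fact_gt0.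
have [pJ pM pN] : [/\ (j%:R : R) ^+ j != 0, (m%:R : R) ^+ m != 0
    & ((j + m)%:R : R) ^+ (j + m) != 0].
  by split; rewrite expf_neq0 // gt_eqF.
move: (expR j%:R) (expR m%:R) (Num.sqrt j%:R) (Num.sqrt m%:R) (Num.sqrt (j + m)%:R)
  eJ eM aJ aM aN => e1 e2 a1 a2 a3 e10 e20 a10 a20 a30.
move: (j`!%:R) (m`!%:R) ((j + m)`!%:R) (j%:R ^+ j) (m%:R ^+ m) ((j + m)%:R ^+ (j + m))
  fJ fM fN pJ pM pN => f1 f2 f3 p1 p2 p3 f10 f20 f30 p10 p20 p30.
move: (_ ^+ j) (_ ^+ m) (theta + j%:R) tJ0 => U V t t0.
by field; rewrite e10 e20 a10 a20 a30 f10 f20 p10 p20 p30 t0.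
Qed.

(** With x j = sqrt((N - j) / (j N)) one has x j^2 - x (j + 1)^2 = 1 / (j (j + 1)),
    so the increment x j - x (j + 1) is explicit up to the factor
    1 + x (j + 1) / x j, which appears in [local_ratio] as well. *)
Lemma failure_pmf_local_ratio (R : realType) (theta : R) (j m : nat) :
  0 < theta -> (0 < j)%N -> (0 < m)%N ->
  failure_pmf theta (j + m) j =
    (tail_approx theta (j + m) j - tail_approx theta (j + m) j.+1)
    * local_ratio theta j m.
Proof.
move=> th0 j0 m0.
have J0 : 0 < j%:R :> R by rewrite ltr0n.
have M1 : 1 <= m%:R :> R by rewrite ler1n.
have M0 : 0 < m%:R :> R by rewrite ltr0n.
have N0 : 0 < (j + m)%:R :> R by rewrite ltr0n addn_gt0 j0.
have S0 : 0 < j.+1%:R :> R by rewrite ltr0n.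
rewrite failure_pmfE // /tail_approx /local_ratio.
pose w : R := Num.sqrt (1 - m%:R^-1) * Num.sqrt (1 - j.+1%:R^-1).
pose x : R := Num.sqrt m%:R / (Num.sqrt j%:R * Num.sqrt (j + m)%:R).
have wM : 0 <= 1 - m%:R^-1 :> R by rewrite subr_ge0 invf_le1.
have wS : 0 <= 1 - j.+1%:R^-1 :> R by rewrite subr_ge0 invf_le1 // ler1n.
have xs : Num.sqrt (m%:R / (j%:R * (j + m)%:R)) = x.
  by rewrite sqrtrM ?ltW // sqrtrV ?mulr_ge0 ?ltW // sqrtrM ?ltW.
have -> : Num.sqrt (((j + m)%:R - j%:R) / (j%:R * (j + m)%:R)) = x.
  by rewrite -xs; congr (Num.sqrt (_ / _)); rewrite natrD; ring.
have -> : Num.sqrt (((j + m)%:R - j.+1%:R) / (j.+1%:R * (j + m)%:R)) = x * w.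
  have -> : ((j + m)%:R - j.+1%:R) / (j.+1%:R * (j + m)%:R)
      = (m%:R / (j%:R * (j + m)%:R)) * ((1 - m%:R^-1) * (1 - j.+1%:R^-1)) :> R.
    rewrite natrD -natr1; field.
    by rewrite -natrD natr1 !gt_eqF.
  rewrite sqrtrM; last by rewrite divr_ge0 ?mulr_ge0 ?ltW.
  by rewrite xs sqrtrM.
rewrite -/w.
have ww : (1 - w) * (1 + w) = (j + m)%:R / (m%:R * j.+1%:R).
  rewrite -subr_sqr expr1n /w exprMn !sqr_sqrtr // natrD -natr1; field.
  by rewrite natr1 !gt_eqF.
have -> : (1 + j%:R^-1) / (1 + theta * j%:R^-1) = j.+1%:R / (theta + j%:R) :> R.
  rewrite -natr1; field.
  by rewrite !gt_eqF // ?addr_gt0.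
have xE : x * (Num.sqrt (j + m)%:R / m%:R) * Num.sqrt (j + m)%:R
    = Num.sqrt (j + m)%:R / (Num.sqrt j%:R * Num.sqrt m%:R).
  have -> : Num.sqrt (j + m)%:R / m%:R = Num.sqrt (j + m)%:R / Num.sqrt m%:R ^+ 2 :> R.
    by rewrite sqr_sqrtr ?ltW.
  rewrite /x; field.
  by rewrite !gt_eqF // sqrtr_gt0.
rewrite -xE.
have NE : (j + m)%:R = Num.sqrt (j + m)%:R ^+ 2 :> R by rewrite sqr_sqrtr ?ltW.
rewrite NE in ww.
have L0 : Num.sqrt (2 * pi) != 0 :> R by rewrite gt_eqF // sqrtr_gt0 mulr_gt0 // pi_gt0.
move: ww; move: (_ ^+ j * _ ^+ m) (stirling_ratio _ _ / _) => U S.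
have t0 : theta + j%:R != 0 by rewrite gt_eqF // addr_gt0.
have {}S0 : j.+1%:R != 0 :> R by rewrite pnatr_eq0.
have {}M0 : m%:R != 0 :> R by rewrite gt_eqF.
move: (Num.sqrt (j + m)%:R) (Num.sqrt (2 * pi)) (theta + j%:R) (j.+1%:R : R) (m%:R : R)
  L0 t0 S0 M0 => g L t r M L0 t0 S0 M0 ww.
transitivity (theta * x * S * U * (r / t) * ((1 - w) * (1 + w))).
  by rewrite ww; field; rewrite t0 S0 M0.
by field; rewrite L0 t0.
Qed.

(** * The probabilities of large blackouts as explicit sums *)

(** Abel's identity with x + y = N. *)
Lemma sum_failure_pmf (R : realType) (theta : R) (N : nat) :
  (0 < N)%N -> \sum_(0 <= j < N.+1) failure_pmf theta N j = 1.
Proof.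
move=> N0; rewrite big_mkord /failure_pmf -mulr_suml.
rewrite abel_identity addrC subrK divff //.
by rewrite expf_neq0 // pnatr_eq0 -lt0n.
Qed.

(** The terms with j < k are genuine probabilities; the total sum 1 turns one
    minus their sum into the sum of the remaining terms. *)
Lemma prob_blackout_ge_failure_pmf (R : realType) (d : measure_display)
    (T : measurableType d) (P : probability T R) (N : nat)
    (X : 'I_N -> {RV P >-> R}) (F : R -> R) (l : nat -> R) (theta : R) (k : nat) :
  mutually_independent X ->
  (forall x r, cdf (X x) r = (F r)%:E) ->
  (forall i j, (1 <= i)%N -> (i <= j)%N -> (j <= N)%N -> l i <= l j) ->
  (forall i, (1 <= i <= N)%N ->
     F (l i) = Num.min 1 ((theta + i%:R - 1) / N%:R)) ->
  (0 < N)%N -> (k <= N)%N -> theta + k%:R - 1 <= N%:R ->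
  P [set w | (k <= blackout_size l (fun x => X x w))%N]
  = (\sum_(k <= j < N.+1) failure_pmf theta N j)%:E.
Proof.
move=> X_indep X_cdf l_incr F_l N0 kN theta_k.
have NR0 : (N%:R : R) != 0 by rewrite pnatr_eq0 -lt0n.
have survE j : (j < k)%N -> 1 - F (l j.+1) = (N%:R - theta - j%:R) / N%:R.
  move=> jk; rewrite F_l ?(leq_trans jk kN) //.
  have -> : theta + j.+1%:R - 1 = theta + j%:R by rewrite -natr1; ring.
  rewrite min_r; first by field.
  rewrite ler_pdivrMr ?ltr0n // mul1r (le_trans _ theta_k) // -addrA lerD2l.
  by rewrite lerBrDr natr1 ler_nat.
pose g j := abel_poly theta j / N%:R ^+ j.
have termE n j : (j <= n)%N -> (j < k)%N ->
    'C(n, j)%:R * g j * (1 - F (l j.+1)) ^+ (n - j) =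
    'C(n, j)%:R * abel_poly theta j * (N%:R - theta - j%:R) ^+ (n - j) / N%:R ^+ n.
  move=> jn jk; rewrite survE // /g expr_div_n.
  have -> : N%:R ^+ n = N%:R ^+ j * N%:R ^+ (n - j) :> R by rewrite -exprD subnKC.
  by field; rewrite !expf_neq0.
rewrite (@prob_blackout_ge _ _ _ _ _ X F l g) //; last first.
  move=> n nk; rewrite (eq_bigr (fun j : 'I_n.+1 =>
    'C(n, j)%:R * abel_poly theta j * (N%:R - theta - j%:R) ^+ (n - j) / N%:R ^+ n)).
    by rewrite -mulr_suml abel_identity addrC subrK divff // expf_neq0.
  by move=> j _; rewrite termE // ?leq_ord // (leq_ltn_trans (leq_ord j)).
congr (_%:E).
rewrite (eq_bigr (fun j : 'I_k => failure_pmf theta N j)) => [|j _]; last first.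
  by rewrite termE // (leq_trans (ltnW (ltn_ord j))).
rewrite -(sum_failure_pmf theta N0) (big_cat_nat (leq0n k) (leqW kN)) /= big_mkord.
by rewrite [X in X - _]addrC addrK.
Qed.

(** Within distance M of the end, the binomial coefficient is at most N^(N - j),
    the factor (theta + j)^(j - 1) is at most expR theta N^(j - 1), and the
    remaining power has bounded base and bounded exponent. *)
Lemma failure_pmf_bound (R : realType) (theta : R) (M N j : nat) :
  0 < theta -> (0 < j)%N -> (j <= N)%N -> (N <= j + M)%N ->
  `|failure_pmf theta N j| <= theta * expR theta * (1 + theta + M%:R) ^+ M / N%:R.
Proof.
move=> th0 j0 jN NjM.
have NR0 : 0 < N%:R :> R by rewrite ltr0n (leq_trans j0).
have th0' := ltW th0.
pose D := 1 + theta + M%:R : R.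
have D1 : 1 <= D by rewrite /D -addrA lerDl addr_ge0.
have D0 : 0 <= D by rewrite (le_trans ler01).
have bin_le : 'C(N, j)%:R <= N%:R ^+ (N - j) :> R.
  rewrite -natrX ler_nat -bin_sub // (leq_trans (leq_pmulr _ (fact_gt0 (N - j)))) //.
  rewrite bin_ffact; elim: (N - j)%N => [|n IHn]; first by rewrite ffactn0 expn0.
  by rewrite ffactnSr expnSr leq_mul // leq_subr.
have abel_le : `|abel_poly theta j| <= theta * expR theta * N%:R ^+ j.-1.
  case: j j0 jN {NjM bin_le} => // j _ jN /=.
  rewrite ger0_norm ?mulr_ge0 ?exprn_ge0 ?addr_ge0 // -mulrA ler_pM2l //.
  apply: (@le_trans _ _ ((expR (theta / N%:R) * N%:R) ^+ j)).
    rewrite lerXn2r ?nnegrE ?addr_ge0 ?mulr_ge0 ?expR_ge0 //.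
    have := ler_wpM2r (ltW NR0) (expR_ge1Dx (theta / N%:R)) => h.
    by apply: (le_trans _ h); rewrite mulrDl mul1r divfK ?gt_eqF // addrC lerD2r ler_nat.
  rewrite exprMn -expRM_natl ler_wpM2r ?exprn_ge0 // ler_expR.
  rewrite mulrCA ler_piMr // ler_pdivrMr // mul1r ler_nat ltnW //.
have pow_le : `|N%:R - theta - j%:R| ^+ (N - j) <= D ^+ M.
  apply: (@le_trans _ _ (D ^+ (N - j))).
    rewrite lerXn2r ?nnegrE // ler_norml /D; apply/andP; split.
      have : j%:R <= N%:R :> R by rewrite ler_nat.
      have : 0 <= M%:R :> R by [].
      by lra.
    have : N%:R <= j%:R + M%:R :> R by rewrite -natrD ler_nat.
    by lra.
  by rewrite ler_weXn2l // leq_subLR.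
rewrite /failure_pmf !normrM normfV !normrX !normr_nat.
rewrite ler_pdivrMr ?exprn_gt0 //.
apply: le_trans (ler_pM _ _ (ler_pM _ _ bin_le abel_le) pow_le) _;
  rewrite ?mulr_ge0 ?exprn_ge0 //.
rewrite le_eqVlt; apply/orP; left; apply/eqP.
have -> : N%:R ^+ N = N%:R ^+ (N - j) * (N%:R ^+ j.-1 * N%:R) :> R.
  by rewrite -exprSr prednK // -exprD subnK.
by rewrite -/D; field; rewrite gt_eqF.
Qed.

(** * Summing the local limit *)

Lemma tail_approx_gt0 (R : realType) (theta : R) (N j : nat) :
  0 < theta -> (0 < j < N)%N -> 0 < tail_approx theta N j.
Proof.
move=> th0 /andP[j0 jN]; rewrite /tail_approx mulr_gt0 //.
  by rewrite divr_gt0 ?mulr_gt0 // sqrtr_gt0 mulr_gt0 // pi_gt0.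
by rewrite sqrtr_gt0 divr_gt0 ?mulr_gt0 ?subr_gt0 ?ltr_nat ?ltr0n // (ltn_trans j0).
Qed.

Lemma tail_approx_decr (R : realType) (theta : R) (N j : nat) :
  0 < theta -> (0 < j < N)%N -> tail_approx theta N j.+1 <= tail_approx theta N j.
Proof.
move=> th0 /andP[j0 jN]; rewrite /tail_approx ler_wpM2l //.
  by rewrite divr_ge0 ?sqrtr_ge0 ?mulr_ge0 ?ltW.
have J0 : 0 < j%:R :> R by rewrite ltr0n.
have N0 : 0 < N%:R :> R by rewrite ltr0n (ltn_trans j0).
apply: ler_wsqrtr; apply: ler_pM.
- by rewrite subr_ge0 ler_nat.
- by rewrite invr_ge0 mulr_ge0.
- by rewrite lerD2l lerN2 ler_nat.
- by rewrite lef_pV2 ?posrE ?mulr_gt0 ?ltr0Sn // ler_pM2r // ler_nat.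
Qed.

(** The increments of [tail_approx] are nonnegative and telescope, so a uniform
    relative error on the terms is a relative error on the sum. *)
Lemma bulk_sum_approx (R : realType) (theta : R) (e : R) (M N K : nat) :
  0 < theta -> (0 < M)%N -> (0 < K)%N -> (K + M <= N)%N ->
  (forall j m, (K <= j)%N -> (M <= m)%N -> `|local_ratio theta j m - 1| <= e) ->
  `|\sum_(K <= j < (N - M).+1) failure_pmf theta N j
    - (tail_approx theta N K - tail_approx theta N (N - M).+1)|
  <= e * (tail_approx theta N K - tail_approx theta N (N - M).+1).
Proof.
move=> th0 M0 K0 KMN rho.
have KNM : (K <= (N - M).+1)%N by rewrite leqW // leq_subRL ?(leq_trans _ KMN) ?leq_addl // addnC.
pose b := tail_approx theta N.
have -> : b K - b (N - M).+1 = \sum_(K <= j < (N - M).+1) (b j - b j.+1).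
  rewrite -[LHS]opprB -(telescope_sumr b KNM) -sumrN.
  by apply: eq_bigr => j _; rewrite opprB.
rewrite -sumrB mulr_sumr; apply: le_trans (ler_norm_sum _ _ _) _.
rewrite big_nat_cond [leRHS]big_nat_cond; apply: ler_sum => j /andP[/andP[Kj jNM] _].
have j0 : (0 < j)%N := leq_trans K0 Kj.
have jN : (j < N)%N by lia.
have mM : (M <= N - j)%N by lia.
have db0 : 0 <= b j - b j.+1 by rewrite subr_ge0 tail_approx_decr // j0.
have -> : failure_pmf theta N j = (b j - b j.+1) * local_ratio theta j (N - j).
  have := @failure_pmf_local_ratio _ theta j (N - j) th0 j0.
  by rewrite subnKC ?(ltnW jN) // subn_gt0; apply.
rewrite -{2}[b j - b j.+1]mulr1 -mulrBr normrM (ger0_norm db0) mulrC.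
by rewrite ler_wpM2r // rho.
Qed.

Lemma tail_approx_ratio (R : realType) (theta : R) (e : R) (M N K : nat) :
  0 < theta -> 0 <= e -> (0 < M)%N -> (0 < K)%N -> (K + M <= N)%N ->
  M%:R <= e ^+ 2 * (N%:R - K%:R) ->
  tail_approx theta N (N - M).+1 <= e * tail_approx theta N K.
Proof.
move=> th0 e0 M0 K0 KMN Me.
rewrite /tail_approx mulrCA ler_wpM2l //.
  by rewrite divr_ge0 ?sqrtr_ge0 ?mulr_ge0 ?ltW.
rewrite -[X in X * Num.sqrt _](ger0_norm e0) -sqrtr_sqr -sqrtrM ?sqr_ge0 //.
apply: ler_wsqrtr; rewrite mulrA.
have K0' : 0 < K%:R :> R by rewrite ltr0n.
have N0' : 0 < N%:R :> R by rewrite ltr0n; lia.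
apply: ler_pM.
- by rewrite subr_ge0 ler_nat; lia.
- by rewrite invr_ge0 mulr_ge0.
- apply: le_trans Me; rewrite lerBlDl -natrD ler_nat; lia.
- by rewrite lef_pV2 ?posrE ?mulr_gt0 ?ltr0Sn // ler_pM2r // ler_nat; lia.
Qed.

Lemma edge_sum_bound (R : realType) (theta : R) (M N : nat) :
  0 < theta -> (0 < M)%N -> (M <= N)%N ->
  `|\sum_((N - M).+1 <= j < N.+1) failure_pmf theta N j|
  <= M%:R * (theta * expR theta * (1 + theta + M%:R) ^+ M) / N%:R.
Proof.
move=> th0 M0 MN; set D := theta * _ * _.
apply: le_trans (ler_norm_sum _ _ _) _.
apply: (@le_trans _ _ (\sum_((N - M).+1 <= j < N.+1) (D / N%:R))).
  rewrite big_nat_cond [leRHS]big_nat_cond; apply: ler_sum => j /andP[/andP[j0 jN] _].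
  by apply: failure_pmf_bound => //; lia.
by rewrite sumr_const_nat subSS subKn // -mulrA mulr_natl.
Qed.

(** This lower bound shows that errors of order 1 / N are negligible when
    N - K is large. *)
Lemma tail_approx_ge (R : realType) (theta : R) (N K : nat) :
  0 < theta -> (0 < K <= N)%N ->
  2 * theta / Num.sqrt (2 * pi) * Num.sqrt (N%:R - K%:R) / N%:R <= tail_approx theta N K.
Proof.
move=> th0 /andP[K0 KN].
have N0 : 0 < N%:R :> R by rewrite ltr0n; lia.
have K0' : 0 < K%:R :> R by rewrite ltr0n.
rewrite /tail_approx -mulrA ler_wpM2l //.
  by rewrite divr_ge0 ?sqrtr_ge0 ?mulr_ge0 ?ltW.
have -> : N%:R^-1 = Num.sqrt (N%:R ^- 2) :> R.
  by rewrite -exprVn sqrtr_sqr ger0_norm // invr_ge0.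
rewrite -sqrtrM ?subr_ge0 ?ler_nat //; apply: ler_wsqrtr.
rewrite ler_wpM2l ?subr_ge0 ?ler_nat // lef_pV2 ?posrE ?exprn_gt0 ?mulr_gt0 //.
by rewrite expr2 ler_pM2r // ler_nat.
Qed.

Lemma tail_sum_approx (R : realType) (theta : R) (e : R) :
  0 < theta -> 0 < e ->
  exists B : nat, forall N K : nat, (B <= K)%N -> (K + B <= N)%N ->
    `|\sum_(K <= j < N.+1) failure_pmf theta N j - tail_approx theta N K|
    <= e * tail_approx theta N K.
Proof.
move=> th0 e0.
(* One third of e for each of three errors: the bulk of the sum, the value of
   tail_approx at the cut N - M, and the last M terms. *)
pose d := e / 3; have d0 : 0 < d by rewrite divr_gt0.
have /cvgr_distC_le /(_ _ d0) [[A1 A2] /= [[M1 _ M1A] [M2 _ M2A]] A12] :=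
  @cvg_local_ratio R theta.
pose M := (maxn M1 M2).+1.
have rho j m : (M <= j)%N -> (M <= m)%N -> `|local_ratio theta j m - 1| <= d.
  move=> Mj Mm; apply: (A12 (j, m)); split => /=; [apply: M1A | apply: M2A] => /=; lia.
pose c : R := 2 * theta / Num.sqrt (2 * pi).
have c0 : 0 < c by rewrite divr_gt0 ?mulr_gt0 // sqrtr_gt0 mulr_gt0 // pi_gt0.
pose D : R := M%:R * (theta * expR theta * (1 + theta + M%:R) ^+ M).
have D0 : 0 <= D.
  by rewrite !mulr_ge0 ?expR_ge0 ?exprn_ge0 ?addr_ge0 // ltW.
(* The three lower bounds on B make the cut legal, and make the second and the
   third error small, in this order. *)
near \oo => B.
have B_M : (M <= B)%N by near: B; exact: nbhs_infty_ge.
have B_d : M%:R / d ^+ 2 <= B%:R by near: B; exact: nbhs_infty_ger.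
have B_c : (D / (d * c)) ^+ 2 <= B%:R by near: B; exact: nbhs_infty_ger.
exists B => N K BK KBN.
have K0 : (0 < K)%N by lia.
have KN : (K <= N)%N by lia.
have KMN : (K + M <= N)%N by lia.
have cutE : (K <= (N - M).+1)%N /\ ((N - M).+1 <= N.+1)%N by lia.
have N0 : 0 < N%:R :> R by rewrite ltr0n; lia.
have BNK : B%:R <= N%:R - K%:R :> R by rewrite lerBrDl -natrD ler_nat.
have bK0 : 0 <= tail_approx theta N K by rewrite ltW // tail_approx_gt0 //; lia.
have bulk : `|\sum_(K <= j < (N - M).+1) failure_pmf theta N j
    - (tail_approx theta N K - tail_approx theta N (N - M).+1)|
    <= d * (tail_approx theta N K - tail_approx theta N (N - M).+1).
  apply: bulk_sum_approx => // j m Kj; apply: rho; lia.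
have cut : tail_approx theta N (N - M).+1 <= d * tail_approx theta N K.
  apply: tail_approx_ratio => //; first exact: ltW.
  rewrite mulrC -ler_pdivrMr ?exprn_gt0 //; exact: le_trans BNK.
have cut0 : 0 <= tail_approx theta N (N - M).+1.
  by rewrite mulr_ge0 ?sqrtr_ge0 // ltW.
have edge : `|\sum_((N - M).+1 <= j < N.+1) failure_pmf theta N j|
    <= d * tail_approx theta N K.
  apply: le_trans (edge_sum_bound th0 _ _) _; [by []|by lia|].
  rewrite -/D; have := @tail_approx_ge R theta N K th0.
  rewrite K0 KN => /(_ isT) bK; apply: le_trans (ler_wpM2l (ltW d0) bK).
  have dc0 : 0 < d * c by exact: mulr_gt0.
  rewrite -/c mulrA ler_wpM2r ?invr_ge0 // mulrA -ler_pdivrMl // [leLHS]mulrC.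
  have q0 : 0 <= D / (d * c) by apply: divr_ge0 => //; apply: mulr_ge0; exact: ltW.
  rewrite -[leLHS](ger0_norm q0) -sqrtr_sqr; apply: ler_wsqrtr.
  exact: le_trans B_c BNK.
have dle : d * (tail_approx theta N K - tail_approx theta N (N - M).+1)
    <= d * tail_approx theta N K.
  by apply: ler_wpM2l; [exact: ltW | rewrite gerBl].
have -> : e = d + d + d by rewrite /d; field.
rewrite (big_cat_nat cutE.1 cutE.2) /=.
set s1 := \sum_(K <= j < _) _ in bulk *.
set s2 := \sum_(_ <= j < N.+1) _ in edge *.
set b := tail_approx theta N K in bulk cut edge dle bK0 *.
set b' := tail_approx theta N _ in bulk cut cut0 dle *.
have -> : s1 + s2 - b = (s1 - (b - b')) + s2 - b' by ring.
rewrite !mulrDl; apply: le_trans (ler_normB _ _) _; apply: lerD.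
  apply: le_trans (ler_normD _ _) _; apply: lerD => //; exact: le_trans dle.
by rewrite ger0_norm.
Unshelve. all: by end_near. Qed.

(** * The limit theorem *)

Lemma sqrt_tail_approx (R : realType) (theta x : R) (N K : nat) :
  0 < x -> x < N%:R -> (0 < K <= N)%N ->
  Num.sqrt (x * N%:R / (N%:R - x)) * tail_approx theta N K =
  2 * theta / Num.sqrt (2 * pi)
    * Num.sqrt ((x / K%:R) * ((N%:R - K%:R) / (N%:R - x))).
Proof.
move=> x0 xN /andP[K0 KN].
have N0 : 0 < N%:R :> R by exact: lt_trans xN.
have K0' : 0 < K%:R :> R by rewrite ltr0n.
have Nx0 : 0 < N%:R - x by rewrite subr_gt0.
rewrite /tail_approx mulrCA -sqrtrM; last by rewrite divr_ge0 ?mulr_ge0 ?ltW.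
congr (_ * Num.sqrt _); field.
by rewrite !gt_eqF.
Qed.

Theorem theorem2 (R : realType)
  (d : nat -> measure_display) (Omega : forall N, measurableType (d N))
  (P : forall N, probability (Omega N) R)
  (C : forall N, 'I_N -> {RV (P N) >-> R})
  (F : R -> R) (l : nat -> nat -> R) (theta : R) (k : nat -> R)
  (C_indep : forall N, mutually_independent (C N))
  (C_cdf : forall N (j : 'I_N) (x : R), cdf (C N j) x = (F x)%:E)
  (F_cont : continuous F)
  (F_density : positive_density_at_zero F)
  (l_incr : forall N i j : nat,
     (1 <= i)%N -> (i <= j)%N -> (j <= N)%N -> l N i <= l N j)
  (theta_gt0 : 0 < theta)
  (F_l : forall N i : nat, (1 <= i <= N)%N ->
     F (l N i) = Num.min 1 ((theta + i%:R - 1) / N%:R))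
  (k_range : forall N : nat, (1 <= N)%N -> 0 < k N <= N%:R)
  (k_infty : k N @[N --> \oo] --> +oo)
  (Nk_infty : N%:R - k N @[N --> \oo] --> +oo) :
  Num.sqrt (k N * N%:R / (N%:R - k N)) *
    fine (P N [set w | k N <= (blackout_size (l N) (fun j => C N j w))%:R])
    @[N --> \oo] --> 2 * theta / Num.sqrt (2 * pi).
Proof.
(* An integer is at least the real number k N exactly when it is at least the
   ceiling of k N. *)
pose K N : nat := `|Num.ceil (k N)|%N.
have K_spec N : (0 < N)%N -> [/\ (0 < K N)%N, (K N <= N)%N, k N <= (K N)%:R,
    (K N)%:R < k N + 1 & forall A : nat, (k N <= A%:R) = (K N <= A)%N].
  move=> /k_range /andP[kN0 kNN].
  have KE : (K N)%:Z = Num.ceil (k N).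
    by rewrite /K gez0_abs // ltW // ceil_gt0.
  have KR : (K N)%:R = (Num.ceil (k N))%:~R :> R by rewrite -KE.
  have leE (A : nat) : (k N <= A%:R) = (K N <= A)%N.
    by rewrite -lez_nat KE ceil_le_int.
  split => //.
  - by rewrite -ltz_nat KE ceil_gt0.
  - by rewrite -leE.
  - by rewrite leE.
  - by rewrite KR -ltrBlDr; have := ceilB1_lt (k N); rewrite intrB.
pose S N := \sum_(K N <= j < N.+1) failure_pmf theta N j.
pose b N := tail_approx theta N (K N).
(* The square root of u N is the factor by which the two square
   roots at k N and at its ceiling differ. *)
pose u N := (k N / (K N)%:R) * ((N%:R - (K N)%:R) / (N%:R - k N)).
have k_ge A : \forall N \near \oo, A <= k N by move/cvgryPge : k_infty; apply.
have Nk_ge A : \forall N \near \oo, A <= N%:R - k N by move/cvgryPge : Nk_infty; apply.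
have k_pos : \forall N \near \oo, 0 < k N.
  by near=> N; apply: (@lt_le_trans _ _ 1) => //; near: N; exact: k_ge.
have Nk_pos : \forall N \near \oo, 0 < N%:R - k N.
  by near=> N; apply: (@lt_le_trans _ _ 1) => //; near: N; exact: Nk_ge.
have kV0 : (k N)^-1 @[N --> \oo] --> (0 : R) by apply/gtr0_cvgV0.
have NkV0 : (N%:R - k N)^-1 @[N --> \oo] --> (0 : R) by apply/gtr0_cvgV0.
have squeeze1 (f g : nat -> R) : g N @[N --> \oo] --> (0 : R) ->
    (\forall N \near \oo, 1 - g N <= f N <= 1) -> f N @[N --> \oo] --> (1 : R).
  move=> g0 fg; apply: (squeeze_cvgr fg); last exact: cvg_cst.
  by rewrite -[X in _ --> X](subr0 1); apply: cvgB => //; exact: cvg_cst.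
have u1 : u N @[N --> \oo] --> (1 : R).
  rewrite -[X in _ --> X]mulr1; apply: cvgM.
    apply: (squeeze1 _ _ kV0); near=> N.
    have k0 : 0 < k N by near: N.
    have [|K0 _ kK Kk _] := K_spec N; first by near: N; exact: nbhs_infty_ge.
    have K0' : 0 < (K N)%:R :> R by rewrite ltr0n.
    rewrite ler_pdivlMr // ler_pdivrMr // mul1r kK andbT mulrBl mul1r lerBlDr.
    by rewrite (le_trans (ltW Kk)) // lerD2l mulrC ler_pdivlMr // mul1r.
  apply: (squeeze1 _ _ NkV0); near=> N.
  have Nk0 : 0 < N%:R - k N by near: N.
  have [|_ _ kK Kk _] := K_spec N; first by near: N; exact: nbhs_infty_ge.
  rewrite ler_pdivlMr // ler_pdivrMr // mul1r mulrBl mul1r mulVf ?gt_eqF //.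
  by apply/andP; split; lra.
have b_pos : \forall N \near \oo, 0 < b N.
  near=> N.
  have Nk1 : 1 <= N%:R - k N by near: N; exact: Nk_ge.
  have [|K0 _ _ Kk _] := K_spec N; first by near: N; exact: nbhs_infty_ge.
  by apply: tail_approx_gt0 => //; rewrite K0 -(ltr_nat R) /=; lra.
have ratio1 : S N / b N @[N --> \oo] --> (1 : R).
  apply/cvgrPdist_le => e e0.
  have [B tailB] := tail_sum_approx theta_gt0 e0.
  near=> N.
  have b0 : 0 < b N by near: N.
  have kB : B%:R <= k N by near: N; exact: k_ge.
  have NkB : B%:R + 1 <= N%:R - k N by near: N; exact: Nk_ge.
  have [|_ _ kK Kk _] := K_spec N; first by near: N; exact: nbhs_infty_ge.
  have := tailB N (K N); rewrite -!(ler_nat R) natrD.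
  move=> /(_ ltac:(lra) ltac:(lra)); rewrite -/(S N) -/(b N) => Sb.
  rewrite distrC -(ler_pM2r b0) -{2}(gtr0_norm b0) -normrM mulrBl mul1r.
  by rewrite divfK ?gt_eqF.
have lim : 2 * theta / Num.sqrt (2 * pi) * Num.sqrt (u N) * (S N / b N) @[N --> \oo]
    --> (2 * theta / Num.sqrt (2 * pi) * Num.sqrt 1 * 1 : R).
  apply: cvgM => //; apply: cvgM; first exact: cvg_cst.
  by apply: continuous_cvg => //; exact: sqrt_continuous.
rewrite sqrtr1 !mulr1 in lim.
apply: (cvg_trans _ lim); apply: near_eq_cvg; near=> N.
have N0 : (0 < N)%N by near: N; exact: nbhs_infty_ge.
have k0 : 0 < k N by near: N.
have b0 : 0 < b N by near: N.
have Nk0 : 0 < N%:R - k N by near: N.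
have Nk_theta : theta <= N%:R - k N by near: N; exact: Nk_ge.
have [K0 KN _ Kk leK] := K_spec N N0.
rewrite (_ : [set w | _] = [set w | (K N <= blackout_size (l N) (fun j => C N j w))%N]);
  last by apply/seteqP; split => w /=; rewrite leK.
rewrite (prob_blackout_ge_failure_pmf (C_indep N) (@C_cdf N) (l_incr N) (F_l N)) //; last lra.
have kN : k N < N%:R by rewrite -subr_gt0.
have KN' : (0 < K N <= N)%N by rewrite K0.
have := sqrt_tail_approx theta k0 kN KN'; rewrite -/(u N) -/(b N) => <-.
rewrite /fine -/(S N) -[LHS]mulrA; congr (_ * _).
by rewrite [b N * _]mulrC divfK // gt_eqF.
Unshelve. all: by end_near. Qed.
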